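(* Let $0<\alpha\leq\sqrt{3}/2$, let $f(z)=\alpha z+\sum_{n=2}^\infty a_nz^n\in\mathcal{K}_s(\alpha)$, and let $\delta=d(f(0),\partial f(\mathbb{D}))$. Then $\mathcal{M}_f(r)\leq\delta$ for all $r=|z|\leq r_s:=1/(1+2\sqrt{1-\alpha^2})$. This radius $r_s$ is sharp for the function $k_\alpha(z)=\alpha z/(1-\sqrt{1-\alpha^2}\,z)$, $z\in\mathbb{D}$; that is, $k_\alpha\in\mathcal{K}_s(\alpha)$ and for $f=k_\alpha$ the inequality $\mathcal{M}_f(r)\leq\delta$ fails for every $r\in(r_s,1)$.
   Context: $\mathbb{D}$ denotes the open unit disk in $\mathbb{C}$. For a complex valued analytic function $F(z)=\sum_{n=0}^\infty A_nz^n$ in $\mathbb{D}$, its majorant series is $\mathcal{M}_F(r):=\sum_{n=0}^\infty |A_n|r^n$ for $0\le r<1$. $d(f(0),\partial f(\mathbb{D}))$ denotes the Euclidean distance between $f(0)$ and the boundary of the domain $f(\mathbb{D})$. A meromorphic univalent (i.e. one-one) function $f$ defined in $\mathbb{D}$ is called spherically convex if $f(\mathbb{D})$ is a spherically convex domain in the Riemann sphere $\hat{\mathbb{C}}$, i.e. for any $w_1,w_2\in f(\mathbb{D})$ the smaller arc of the greatest circle (spherical geodesic) between $w_1$ and $w_2$ lies in $f(\mathbb{D})$. For $0<\alpha\leq 1$, $\mathcal{K}_s(\alpha)$ is the class of all spherically convex functions in the normalized form $f(z)=\alpha z+a_2z^2+a_3z^3+\cdots$. *)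

(* Defs.v *)
From Stdlib Require Import Reals.
From Coquelicot Require Import Coquelicot.

Open Scope R_scope.

(* The Riemann sphere; [None] is the point at infinity. *)
Definition Chat : Type := option C.

Definition Chat_inv (w : Chat) : Chat :=
  match w with
  | None => Some (RtoC 0)
  | Some u => if Ceq_dec u (RtoC 0) then None else Some (Cinv u)
  end.

(* Stereographic projection onto the unit sphere of R^3; infinity is the
   north pole. *)
Definition stereo (w : Chat) : R * R * R :=
  match w with
  | None => (0, 0, 1)
  | Some u =>
      let m := (Cmod u) ^ 2 in
      (2 * Re u / (1 + m), 2 * Im u / (1 + m), (m - 1) / (1 + m))
  end.

(* The great circle through two non-antipodal points p, q of the unit sphere
   is the trace on the sphere of the plane spanned by p and q, and its smaller
   arc from p to q is the trace of the cone of nonnegative combinations of p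
   and q.  Antipodal points have no distinguished smaller arc; for them only
   the two end points satisfy this predicate. *)
Definition on_minor_arc (w1 w2 w : Chat) : Prop :=
  exists s t : R, 0 <= s /\ 0 <= t /\
    stereo w = plus (scal s (stereo w1)) (scal t (stereo w2)).

Definition spherically_convex (E : Chat -> Prop) : Prop :=
  forall w1 w2 w : Chat, E w1 -> E w2 -> on_minor_arc w1 w2 w -> E w.

(* A function on the unit disk is represented by a total function on C; no
   definition below looks at its values outside the disk. *)
Definition in_disk (z : C) : Prop := Cmod z < 1.

Definition disk_image (f : C -> Chat) (w : Chat) : Prop :=
  exists z : C, in_disk z /\ f z = w.

Definition expands_at (f : C -> Chat) (z0 : C) (a : nat -> C) : Prop :=
  locally z0 (fun z : C =>
    exists w : C, f z = Some w /\ is_pseries a (Cminus z z0) w).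

Definition analytic_at (f : C -> Chat) (z0 : C) : Prop :=
  exists a : nat -> C, expands_at f z0 a.

(* The second case covers the poles: 1/f is analytic where f is infinite. *)
Definition meromorphic_on_disk (f : C -> Chat) : Prop :=
  forall z0 : C, in_disk z0 ->
    analytic_at f z0 \/ analytic_at (fun z => Chat_inv (f z)) z0.

Definition univalent_on_disk (f : C -> Chat) : Prop :=
  forall z1 z2 : C, in_disk z1 -> in_disk z2 -> f z1 = f z2 -> z1 = z2.

(* The image of the disk under a univalent meromorphic function is
   automatically open and connected, so only convexity is required of it. *)
Definition spherically_convex_function (f : C -> Chat) : Prop :=
  meromorphic_on_disk f /\ univalent_on_disk f /\
  spherically_convex (disk_image f).

Definition Ks (alpha : R) (f : C -> Chat) : Prop :=
  spherically_convex_function f /\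
  exists a : nat -> C,
    expands_at f (RtoC 0) a /\ a 0%nat = RtoC 0 /\ a 1%nat = RtoC alpha.

(* For r >= 0 the partial sums are nondecreasing, so this is the sum of the
   series in [0, +oo], equal to p_infty exactly when the series diverges. *)
Definition majorant_series (a : nat -> C) (r : R) : Rbar :=
  Lim_seq (sum_n (fun n => Cmod (a n) * r ^ n)).

Definition boundary (E : C -> Prop) (w : C) : Prop :=
  ~ locally w (fun u => ~ E u) /\ ~ locally w E.

(* d(f(0), boundary of f(D)) for f(0) finite.  Only finite boundary points are
   considered, infinity being at infinite Euclidean distance. *)
Definition boundary_dist (f : C -> Chat) : Rbar :=
  Glb_Rbar (fun d : R => exists w0 w : C,
    f (RtoC 0) = Some w0 /\
    boundary (fun u => disk_image f (Some u)) w /\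
    d = Cmod (Cminus w w0)).

Definition bohr_radius_s (alpha : R) : R := 1 / (1 + 2 * sqrt (1 - alpha ^ 2)).

Definition k_extremal (alpha : R) (z : C) : Chat :=
  Some (Cdiv (Cmult (RtoC alpha) z)
             (Cminus (RtoC 1) (Cmult (RtoC (sqrt (1 - alpha ^ 2))) z))).

(* Main.v *)
Require Import Defs.
From Stdlib Require Import Reals.
From Coquelicot Require Import Coquelicot.
From Stdlib Require Import Arith Lra Lia Classical ClassicalEpsilon.

Open Scope R_scope.

(** Why the theorem holds. Let [w] be a finite value omitted by [f]. The image of
    the disk under [f], seen on the sphere, spans a convex cone that misses the
    direction of [w], so a plane through the centre of the sphere separates the two
    ([cone_separation], [spherically_convex_support]). Hence [f] takes its values in
    a closed hemisphere; in the plane this is a disk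
    [|u| ^ 2 - 2 Re (u conj p) <= 1] of centre [p] and radius [R = sqrt (1 + |p| ^ 2)],
    and [w] is not an interior point of it, so [R - |p| <= |w|]. It is enough to
    bound the majorant series by [R - |p|], since boundary points of the image are
    limits of omitted values.

    On this disk [omega = R f / (1 + conj p f)] is bounded by one and vanishes at the
    origin. Rogosinski's argument, applied to [R f = omega (1 + conj p f)], gives
    [sum_(k <= N + 1) |a_k| ^ 2 <= b ^ 2 + c ^ 2 sum_(k <= N) |a_k| ^ 2] with
    [b = 1 / R] and [c = |p| / R], so that [b ^ 2 + c ^ 2 = 1]
    ([cap_square_sum_le]). Summation by parts and a weighted mean inequality turn
    this into [sum |a_k| r ^ k <= b / (1 + c) = R - |p|], provided that [r <= 1 / 2] and
    [r (1 + 2 c) <= 1] ([majorant_partial_sum_le]). The square sum inequality for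
    [N = 0] reads [alpha <= b], that is [c <= sqrt (1 - alpha ^ 2)], so the second
    condition follows from [r <= bohr_radius_s alpha]; the first one is where
    [alpha <= sqrt 3 / 2] enters.

    The function theory behind Rogosinski's argument is Bessel's inequality for the
    Taylor coefficients at the origin of a function that is only known to be
    locally a power series at each point of the disk. It rests on one fact: the
    circle means of a holomorphic function on the punctured disk do not depend on
    the radius ([circle_integral_constant]). This gives Cauchy's formula for the
    coefficients of a finite jet ([circle_integral_coeff]), and with it both
    Bessel's inequality ([jet_square_sum_le]) and the uniqueness of the
    coefficients ([jet_unique]).

    For sharpness, [k_extremal alpha] maps the disk onto a hemisphere whose boundary
    contains [- alpha / (1 + c)] with [c = sqrt (1 - alpha ^ 2)], and its majorant
    series [alpha r / (1 - c r)] exceeds [alpha / (1 + c)] as soon as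
    [r (1 + 2 c) > 1]. *)

(** * Germs of functions of a complex variable *)

Lemma locally_disc (z0 : C) (P : C -> Prop) :
  locally (T := C_UniformSpace) z0 P <->
  exists d, 0 < d /\ forall z, Cmod (z - z0) < d -> P z.
Proof.
  split.
  - intros [e He]. exists e. split; [apply cond_pos|]. intros z Hz. apply He.
    pose proof (Rmax_Cmod (z - z0)%C) as Hm.
    split; eapply Rle_lt_trans; [| exact Hz | | exact Hz];
      (eapply Rle_trans; [| exact Hm]); [apply Rmax_l | apply Rmax_r].
  - intros (d & Hd & H).
    assert (Hd2 : 0 < d / 2) by lra.
    exists (mkposreal _ Hd2). intros z [H1 H2]. apply H.
    eapply Rle_lt_trans; [apply Cmod_2Rmax|].
    assert (Hs : sqrt 2 < 2).
    { rewrite <- (sqrt_square 2) at 2 by lra. apply sqrt_lt_1; lra. }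
    assert (Hm : Rmax (Rabs (fst (z - z0)%C)) (Rabs (snd (z - z0)%C)) < d / 2).
    { apply Rmax_lub_lt; [exact H1 | exact H2]. }
    assert (0 <= Rmax (Rabs (fst (z - z0)%C)) (Rabs (snd (z - z0)%C))).
    { eapply Rle_trans; [apply Rabs_pos | apply Rmax_l]. }
    assert (0 <= sqrt 2) by apply sqrt_pos. nra.
Qed.

Lemma Cmod_sub_sym (x y : C) : Cmod (x - y) = Cmod (y - x).
Proof. rewrite <- Cmod_opp. f_equal. ring. Qed.

Lemma Cmod_sub_triangle (x y z : C) : Cmod (x - z) <= Cmod (x - y) + Cmod (y - z).
Proof. replace (x - z)%C with ((x - y) + (y - z))%C by ring. apply Cmod_triangle. Qed.

Lemma Cmod_sub_ge (x y : C) : Cmod x - Cmod y <= Cmod (x - y).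
Proof.
  pose proof (Cmod_triangle (x - y) y) as H.
  replace (x - y + y)%C with x in H by ring. lra.
Qed.

Lemma Cmod_sub_le (x y : C) : Cmod (x - y) <= Cmod x + Cmod y.
Proof. unfold Cminus. rewrite <- (Cmod_opp y). apply Cmod_triangle. Qed.

Lemma Rabs_Re_le (z : C) : Rabs (Re z) <= Cmod z.
Proof. apply re_le_Cmod. Qed.

Lemma Rabs_Im_le (z : C) : Rabs (Im z) <= Cmod z.
Proof. eapply Rle_trans; [apply Rmax_r | apply (Rmax_Cmod z)]. Qed.

Fixpoint csum (t : nat -> C) (N : nat) : C :=
  match N with
  | O => t O
  | S n => (csum t n + t (S n))%C
  end.

Lemma csum_S t N : csum t (S N) = (csum t N + t (S N))%C.
Proof. reflexivity. Qed.

Definition cpoly (a : nat -> C) (N : nat) (z : C) : C :=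
  csum (fun k => (a k * z ^ k)%C) N.

Lemma cpoly_S a N z : cpoly a (S N) z = (cpoly a N z + a (S N) * z ^ S N)%C.
Proof. reflexivity. Qed.

Lemma csum_sum_n t N : sum_n (G := C_AbelianMonoid) t N = csum t N.
Proof.
  induction N; simpl.
  - apply sum_O.
  - rewrite sum_Sn, IHN. reflexivity.
Qed.

Lemma is_series_csum t l :
  is_series (K := C_AbsRing) (V := C_NormedModule) t l ->
  forall e, 0 < e -> exists M, forall n, (M <= n)%nat -> Cmod (csum t n - l) < e.
Proof.
  intros H e He.
  destruct (H (fun z : C => Cmod (z - l) < e)) as [M HM].
  - apply (proj2 (locally_disc l (fun z => Cmod (z - l) < e))). exists e. auto.
  - exists M. intros n Hn. rewrite <- csum_sum_n. apply HM. exact Hn.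
Qed.

Lemma csum_is_series t l :
  (forall e, 0 < e -> exists M, forall n, (M <= n)%nat -> Cmod (csum t n - l) < e) ->
  is_series (K := C_AbsRing) (V := C_NormedModule) t l.
Proof.
  intros H P HP. apply locally_disc in HP. destruct HP as (d & Hd & HP).
  destruct (H d Hd) as [M HM]. exists M. intros n Hn.
  apply HP. rewrite csum_sum_n. apply HM. exact Hn.
Qed.

Lemma csum_geom_tail t B q N M :
  0 <= B -> 0 <= q <= 1 / 2 -> (forall k, (N < k)%nat -> Cmod (t k) <= B * q ^ k) ->
  (N <= M)%nat -> Cmod (csum t M - csum t N) <= 2 * B * q ^ (S N) * (1 - (1/2) ^ (M - N)).
Proof.
  intros HB Hq Ht HNM. induction HNM as [|M HNM IH].
  - replace (csum t N - csum t N)%C with (RtoC 0) by ring. rewrite Cmod_0.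
    rewrite Nat.sub_diag. simpl. lra.
  - simpl csum. replace (csum t M + t (S M) - csum t N)%C
      with ((csum t M - csum t N) + t (S M))%C by ring.
    eapply Rle_trans; [apply Cmod_triangle|].
    assert (H1 : Cmod (t (S M)) <= B * q ^ S M) by (apply Ht; lia).
    replace (S M - N)%nat with (S (M - N)) by lia.
    assert (H2 : q ^ (S M) <= q ^ (S N) * (1/2) ^ (M - N)).
    { replace (S M) with (S N + (M - N))%nat by lia. rewrite pow_add.
      apply Rmult_le_compat_l; [apply pow_le; lra|]. apply pow_incr. lra. }
    assert (B * q ^ S M <= B * (q ^ S N * (1 / 2) ^ (M - N)))
      by (apply Rmult_le_compat_l; assumption).
    replace ((1/2) ^ S (M - N)) with (1/2 * (1/2) ^ (M - N)) by reflexivity. lra.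
Qed.

Lemma is_series_geom_tail t l B q N :
  0 <= B -> 0 <= q <= 1 / 2 -> (forall k, (N < k)%nat -> Cmod (t k) <= B * q ^ k) ->
  is_series (K := C_AbsRing) (V := C_NormedModule) t l ->
  Cmod (l - csum t N) <= 2 * B * q ^ (S N).
Proof.
  intros HB Hq Ht Hl. apply le_epsilon. intros e He.
  destruct (is_series_csum t l Hl e He) as [M HM].
  specialize (HM (M + N)%nat ltac:(lia)).
  pose proof (csum_geom_tail t B q N (M + N) HB Hq Ht ltac:(lia)) as HT.
  pose proof (Cmod_sub_triangle l (csum t (M + N)) (csum t N)) as H3.
  rewrite (Cmod_sub_sym l (csum t (M + N))) in H3.
  assert (0 <= (1/2) ^ (M + N - N)) by (apply pow_le; lra).
  assert (0 <= 2 * B * q ^ S N).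
  { apply Rmult_le_pos; [lra | apply pow_le; lra]. }
  nra.
Qed.

Lemma is_pseries_csum a z l :
  is_pseries (K := C_AbsRing) (V := C_NormedModule) a z l ->
  is_series (K := C_AbsRing) (V := C_NormedModule) (fun k => (a k * z ^ k)%C) l.
Proof.
  intros H. unfold is_pseries in H. eapply is_series_ext; [|exact H].
  intros n. apply Cmult_comm.
Qed.

(** Convergence at a single nonzero point already forces geometric growth of the
    coefficients. *)
Lemma is_pseries_coeff_bound a h l :
  0 < h -> is_pseries (K := C_AbsRing) (V := C_NormedModule) a (RtoC h) l ->
  exists M, 0 < M /\ forall n, Cmod (a n) <= M * (/ h) ^ n.
Proof.
  intros Hh H. apply is_pseries_csum in H.
  destruct (is_series_csum _ _ H 1 ltac:(lra)) as [N HN].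
  assert (Htail : forall n, (N < n)%nat -> Cmod (a n * RtoC h ^ n) <= 2).
  { intros [|n] Hn; [lia|].
    set (t := fun k : nat => (a k * RtoC h ^ k)%C) in *.
    change (Cmod (t (S n)) <= 2).
    replace (t (S n)) with ((csum t (S n) - l) - (csum t n - l))%C by (simpl; ring).
    eapply Rle_trans; [apply Cmod_sub_le|].
    pose proof (HN (S n) ltac:(lia)). pose proof (HN n ltac:(lia)). lra. }
  assert (Hall : forall N, exists B, forall n, (n <= N)%nat -> Cmod (a n * RtoC h ^ n) <= B).
  { clear. induction N as [|N [B HB]].
    - exists (Cmod (a 0%nat * RtoC h ^ 0)). intros n Hn.
      replace n with 0%nat by lia. lra.
    - exists (Rmax B (Cmod (a (S N) * RtoC h ^ S N))). intros n Hn.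
      destruct (Nat.eq_dec n (S N)) as [->|Hne]; [apply Rmax_r|].
      eapply Rle_trans; [apply HB; lia | apply Rmax_l]. }
  destruct (Hall N) as [B HB].
  exists (Rmax B 2). split; [apply Rlt_le_trans with 2; [lra | apply Rmax_r]|].
  intros n.
  assert (Hn : Cmod (a n * RtoC h ^ n) <= Rmax B 2).
  { destruct (Nat.le_gt_cases n N) as [Hle|Hlt].
    - eapply Rle_trans; [apply HB; lia | apply Rmax_l].
    - eapply Rle_trans; [apply Htail; lia | apply Rmax_r]. }
  rewrite Cmod_mult, Cmod_pow, Cmod_R, (Rabs_pos_eq h) in Hn by lra.
  rewrite pow_inv. assert (0 < h ^ n) by (apply pow_lt; lra).
  apply Rmult_le_reg_r with (h ^ n); [assumption|].
  rewrite Rmult_assoc, Rinv_l, Rmult_1_r by lra. exact Hn.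
Qed.

(** The geometric bound on the coefficients is what makes the tail estimates below
    uniform in [z]. *)
Lemma expands_at_bounds f z0 a :
  expands_at f z0 a ->
  exists M k d, 0 < M /\ 0 < k /\ 0 < d /\
    (forall n, Cmod (a n) <= M * k ^ n) /\
    (forall z, Cmod (z - z0) < d -> exists w, f z = Some w /\
       is_series (K := C_AbsRing) (V := C_NormedModule) (fun n => (a n * (z - z0) ^ n)%C) w).
Proof.
  intros H. apply locally_disc in H. destruct H as (d & Hd & H).
  assert (Hz : Cmod ((z0 + RtoC (d / 2)) - z0) < d).
  { replace ((z0 + RtoC (d / 2)) - z0)%C with (RtoC (d / 2)) by ring.
    rewrite Cmod_R, Rabs_pos_eq; lra. }
  destruct (H _ Hz) as (w & _ & Hw).
  replace ((z0 + RtoC (d / 2)) - z0)%C with (RtoC (d / 2)) in Hw by ring.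
  destruct (is_pseries_coeff_bound a (d / 2) w ltac:(lra) Hw) as (M & HM & Hb).
  exists M, (/ (d / 2)), d. repeat split; auto.
  - apply Rinv_0_lt_compat. lra.
  - intros z Hz'. destruct (H z Hz') as (u & Hu & Hs). exists u. split; [exact Hu|].
    apply is_pseries_csum. exact Hs.
Qed.

Definition finite_part (w : Chat) : C :=
  match w with Some u => u | None => RtoC 0 end.

(** Every argument below involves finitely many coefficients at a time, so that
    the convergence of the Taylor series on the whole disk is never an issue. *)
Definition has_jet (F : C -> C) (a : nat -> C) (N : nat) : Prop :=
  exists K d, 0 <= K /\ 0 < d /\
    forall z, Cmod z < d -> Cmod (F z - cpoly a N z) <= K * Cmod z ^ S N.

Lemma expands_at_jet f a N :
  expands_at f (RtoC 0) a -> has_jet (fun z => finite_part (f z)) a N.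
Proof.
  intros H. destruct (expands_at_bounds f _ a H) as (M & k & d & HM & Hk & Hd & Ha & Hf).
  exists (2 * M * k ^ S N), (Rmin d (/ (2 * k))). split; [|split].
  - apply Rmult_le_pos; [lra | apply pow_le; lra].
  - apply Rmin_pos; [lra | apply Rinv_0_lt_compat; lra].
  - intros z Hz.
    assert (Hz1 : Cmod z < d) by (eapply Rlt_le_trans; [exact Hz | apply Rmin_l]).
    assert (Hz2 : Cmod z < / (2 * k)) by (eapply Rlt_le_trans; [exact Hz | apply Rmin_r]).
    destruct (Hf z) as (w & Hw & Hs).
    { replace (z - 0)%C with z by ring. exact Hz1. }
    rewrite Hw. simpl finite_part.
    replace (2 * M * k ^ S N * Cmod z ^ S N) with (2 * M * (k * Cmod z) ^ S N)
      by (rewrite Rpow_mult_distr; ring).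
    assert (Hq : 0 <= k * Cmod z <= 1 / 2).
    { split; [apply Rmult_le_pos; [lra | apply Cmod_ge_0]|].
      apply Rmult_lt_compat_l with (r := k) in Hz2; [|lra].
      replace (k * / (2 * k)) with (1 / 2) in Hz2 by (field; lra). lra. }
    unfold cpoly. apply is_series_geom_tail; [lra | exact Hq | |].
    + intros n _. rewrite Cmod_mult, Cmod_pow, Rpow_mult_distr, <- Rmult_assoc.
      apply Rmult_le_compat_r; [apply pow_le, Cmod_ge_0 | apply Ha].
    + replace (z - 0)%C with z in Hs by ring. exact Hs.
Qed.

(** * Strict complex derivatives *)

(** The two-point form of differentiability makes the derivative automatically
    continuous, and it is a condition at the single point [z0]. *)
Definition is_strict_derive (F : C -> C) (z0 l : C) : Prop :=
  forall e, 0 < e -> exists d, 0 < d /\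
    forall z1 z2, Cmod (z1 - z0) < d -> Cmod (z2 - z0) < d ->
      Cmod (F z1 - F z2 - l * (z1 - z2)) <= e * Cmod (z1 - z2).

Definition holomorphic_on (U : C -> Prop) (F : C -> C) : Prop :=
  forall z, U z -> exists l, is_strict_derive F z l.

Lemma Cmod_pow_sub (n : nat) (r : R) (h k : C) :
  Cmod h <= r -> Cmod k <= r ->
  Cmod (h ^ S n - k ^ S n) <= (2 * r) ^ n * Cmod (h - k).
Proof.
  intros Hh Hk. assert (Hr : 0 <= r) by (eapply Rle_trans; [apply Cmod_ge_0 | exact Hh]).
  induction n as [|n IH].
  - rewrite !Cpow_1_r. simpl. lra.
  - replace (h ^ S (S n) - k ^ S (S n))%C
      with (h * (h ^ S n - k ^ S n) + k ^ S n * (h - k))%C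
      by (rewrite !(Cpow_S _ (S n)); ring).
    eapply Rle_trans; [apply Cmod_triangle|]. rewrite !Cmod_mult, Cmod_pow.
    assert (H1 : Cmod h * Cmod (h ^ S n - k ^ S n) <= r * ((2 * r) ^ n * Cmod (h - k))).
    { apply Rmult_le_compat; auto using Cmod_ge_0. }
    assert (H2 : Cmod k ^ S n <= r * (2 * r) ^ n).
    { simpl. apply Rmult_le_compat; auto using Cmod_ge_0, pow_le.
      apply pow_incr. pose proof (Cmod_ge_0 k). lra. }
    assert (H3 : Cmod k ^ S n * Cmod (h - k) <= r * (2 * r) ^ n * Cmod (h - k)).
    { apply Rmult_le_compat_r; [apply Cmod_ge_0 | exact H2]. }
    simpl ((2 * r) ^ S n). lra.
Qed.

(** Term by term, [h ^ n - k ^ n] carries a factor [h - k], and the terms of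
    degree at least two carry in addition a small factor. *)
Lemma expands_at_strict_derive f z0 a :
  expands_at f z0 a -> is_strict_derive (fun z => finite_part (f z)) z0 (a 1%nat).
Proof.
  intros H e He.
  destruct (expands_at_bounds f _ a H) as (M & k & d & HM & Hk & Hd & Ha & Hf).
  set (r := Rmin (d / 2) (Rmin (/ (4 * k)) (e / (4 * M * k ^ 2)))).
  assert (Hk2 : 0 < 4 * M * k ^ 2) by (apply Rmult_lt_0_compat; [lra | apply pow_lt; lra]).
  assert (Hr : 0 < r).
  { repeat apply Rmin_pos; [lra | apply Rinv_0_lt_compat; lra |].
    apply Rdiv_lt_0_compat; assumption. }
  assert (Hr1 : r < d).
  { eapply Rle_lt_trans; [apply Rmin_l | lra]. }
  assert (Hr2 : r * k <= 1 / 4).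
  { assert (r <= / (4 * k)) as Hx.
    { eapply Rle_trans; [apply Rmin_r | apply Rmin_l]. }
    apply Rmult_le_compat_r with (r := k) in Hx; [|lra].
    replace (/ (4 * k) * k) with (1 / 4) in Hx by (field; lra). exact Hx. }
  assert (Hr3 : 4 * M * k ^ 2 * r <= e).
  { assert (r <= e / (4 * M * k ^ 2)) as Hx.
    { eapply Rle_trans; [apply Rmin_r | apply Rmin_r]. }
    apply Rmult_le_compat_l with (r := 4 * M * k ^ 2) in Hx; [|lra].
    replace (4 * M * k ^ 2 * (e / (4 * M * k ^ 2))) with e in Hx by (field; lra). exact Hx. }
  exists r. split; [exact Hr|]. intros z1 z2 H1 H2.
  destruct (Hf z1 ltac:(lra)) as (w1 & Hw1 & Hs1).
  destruct (Hf z2 ltac:(lra)) as (w2 & Hw2 & Hs2).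
  rewrite Hw1, Hw2. simpl finite_part.
  pose proof (is_series_minus _ _ _ _ Hs1 Hs2) as Hs.
  set (D := Cmod (z1 - z2)).
  assert (HD : 0 <= D) by apply Cmod_ge_0.
  assert (HT : Cmod ((w1 - w2) -
     csum (fun n => a n * (z1 - z0) ^ n - a n * (z2 - z0) ^ n)%C 1)
     <= 2 * (M * D / (2 * r)) * (2 * r * k) ^ 2).
  { apply is_series_geom_tail; [| nra | | exact Hs].
    - apply Rmult_le_pos; [nra|]. apply Rlt_le, Rinv_0_lt_compat. lra.
    - intros [|n] Hn; [lia|].
      replace (a (S n) * (z1 - z0) ^ S n - a (S n) * (z2 - z0) ^ S n)%C
        with (a (S n) * ((z1 - z0) ^ S n - (z2 - z0) ^ S n))%C by ring.
      rewrite Cmod_mult.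
      pose proof (Cmod_pow_sub n r _ _ (Rlt_le _ _ H1) (Rlt_le _ _ H2)) as Hp.
      replace (z1 - z0 - (z2 - z0))%C with (z1 - z2)%C in Hp by ring. fold D in Hp.
      eapply Rle_trans.
      + apply Rmult_le_compat; [apply Cmod_ge_0 | apply Cmod_ge_0 | apply Ha | exact Hp].
      + right. rewrite (Rpow_mult_distr (2 * r) k). simpl. field. lra. }
  replace (w1 - w2 - a 1%nat * (z1 - z2))%C with
    ((w1 - w2) - csum (fun n => a n * (z1 - z0) ^ n - a n * (z2 - z0) ^ n)%C 1)%C
    by (simpl; ring).
  eapply Rle_trans; [exact HT|].
  replace (2 * (M * D / (2 * r)) * (2 * r * k) ^ 2) with (4 * M * k ^ 2 * r * D)
    by (field; lra).
  apply Rmult_le_compat_r; assumption.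
Qed.

Lemma strict_derive_ext_loc F G z0 l d :
  0 < d -> (forall z, Cmod (z - z0) < d -> F z = G z) -> is_strict_derive F z0 l -> is_strict_derive G z0 l.
Proof.
  intros Hd HFG HF e He. destruct (HF e He) as (d1 & Hd1 & H).
  exists (Rmin d d1). split; [apply Rmin_pos; assumption|]. intros z1 z2 H1 H2.
  pose proof (Rmin_l d d1). pose proof (Rmin_r d d1).
  rewrite <- !HFG by lra. apply H; lra.
Qed.

Lemma strict_derive_continuous F z0 l :
  is_strict_derive F z0 l -> forall e, 0 < e -> exists d, 0 < d /\
    forall z, Cmod (z - z0) < d -> Cmod (F z - F z0) < e.
Proof.
  intros H e He. destruct (H 1 ltac:(lra)) as (d & Hd & HF).
  pose proof (Cmod_ge_0 l) as Hl.
  exists (Rmin d (e / (2 + Cmod l))). split.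
  { apply Rmin_pos; [assumption|]. apply Rdiv_lt_0_compat; lra. }
  intros z Hz.
  pose proof (Rmin_l d (e / (2 + Cmod l))). pose proof (Rmin_r d (e / (2 + Cmod l))).
  specialize (HF z z0 ltac:(lra)).
  replace (z0 - z0)%C with (RtoC 0) in HF by ring. rewrite Cmod_0 in HF. specialize (HF Hd).
  replace (F z - F z0)%C with ((F z - F z0 - l * (z - z0)) + l * (z - z0))%C by ring.
  eapply Rle_lt_trans; [apply Cmod_triangle|]. rewrite Cmod_mult.
  assert (Hlt : Cmod (z - z0) < e / (2 + Cmod l)) by lra.
  apply Rmult_lt_compat_r with (r := 2 + Cmod l) in Hlt; [|lra].
  replace (e / (2 + Cmod l) * (2 + Cmod l)) with e in Hlt by (field; lra).
  pose proof (Cmod_ge_0 (z - z0)). lra.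
Qed.

Lemma strict_derive_const c z0 : is_strict_derive (fun _ => c) z0 (RtoC 0).
Proof.
  intros e He. exists 1. split; [lra|]. intros z1 z2 _ _.
  replace (c - c - 0 * (z1 - z2))%C with (RtoC 0) by ring. rewrite Cmod_0.
  apply Rmult_le_pos; [lra | apply Cmod_ge_0].
Qed.

Lemma strict_derive_id z0 : is_strict_derive (fun z => z) z0 (RtoC 1).
Proof.
  intros e He. exists 1. split; [lra|]. intros z1 z2 _ _.
  replace (z1 - z2 - 1 * (z1 - z2))%C with (RtoC 0) by ring. rewrite Cmod_0.
  apply Rmult_le_pos; [lra | apply Cmod_ge_0].
Qed.

Lemma strict_derive_plus F G z0 l m :
  is_strict_derive F z0 l -> is_strict_derive G z0 m -> is_strict_derive (fun z => F z + G z)%C z0 (l + m)%C.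
Proof.
  intros HF HG e He.
  destruct (HF (e / 2) ltac:(lra)) as (d1 & Hd1 & H1).
  destruct (HG (e / 2) ltac:(lra)) as (d2 & Hd2 & H2).
  exists (Rmin d1 d2). split; [apply Rmin_pos; assumption|]. intros z1 z2 Hz1 Hz2.
  pose proof (Rmin_l d1 d2). pose proof (Rmin_r d1 d2).
  specialize (H1 z1 z2 ltac:(lra) ltac:(lra)). specialize (H2 z1 z2 ltac:(lra) ltac:(lra)).
  replace (F z1 + G z1 - (F z2 + G z2) - (l + m) * (z1 - z2))%C
    with ((F z1 - F z2 - l * (z1 - z2)) + (G z1 - G z2 - m * (z1 - z2)))%C by ring.
  eapply Rle_trans; [apply Cmod_triangle|]. lra.
Qed.

Lemma strict_derive_mult F G z0 l m :
  is_strict_derive F z0 l -> is_strict_derive G z0 m ->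
  is_strict_derive (fun z => F z * G z)%C z0 (l * G z0 + F z0 * m)%C.
Proof.
  intros HF HG e He.
  pose proof (Cmod_ge_0 l) as Pl. pose proof (Cmod_ge_0 m) as Pm.
  pose proof (Cmod_ge_0 (F z0)) as PF. pose proof (Cmod_ge_0 (G z0)) as PG.
  set (A := 1 + Cmod (F z0) + Cmod (G z0) + Cmod l + Cmod m).
  assert (HA : 1 <= A) by (unfold A; lra).
  set (e' := Rmin 1 (e / (4 * A))).
  assert (He' : 0 < e').
  { apply Rmin_pos; [lra|]. apply Rdiv_lt_0_compat; lra. }
  assert (He1 : e' <= 1) by apply Rmin_l.
  assert (HeA : 4 * A * e' <= e).
  { assert (Hx : e' <= e / (4 * A)) by apply Rmin_r.
    apply Rmult_le_compat_l with (r := 4 * A) in Hx; [|lra].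
    replace (4 * A * (e / (4 * A))) with e in Hx by (field; lra). exact Hx. }
  destruct (HF e' He') as (d1 & Hd1 & H1). destruct (HG e' He') as (d2 & Hd2 & H2).
  destruct (strict_derive_continuous F z0 l HF e' He') as (d3 & Hd3 & H3).
  destruct (strict_derive_continuous G z0 m HG e' He') as (d4 & Hd4 & H4).
  exists (Rmin (Rmin d1 d2) (Rmin d3 d4)). split; [repeat apply Rmin_pos; assumption|].
  intros z1 z2 Hz1 Hz2.
  pose proof (Rmin_l d1 d2). pose proof (Rmin_r d1 d2).
  pose proof (Rmin_l d3 d4). pose proof (Rmin_r d3 d4).
  pose proof (Rmin_l (Rmin d1 d2) (Rmin d3 d4)).
  pose proof (Rmin_r (Rmin d1 d2) (Rmin d3 d4)).
  specialize (H1 z1 z2 ltac:(lra) ltac:(lra)). specialize (H2 z1 z2 ltac:(lra) ltac:(lra)).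
  pose proof (H3 z2 ltac:(lra)) as H32. pose proof (H4 z1 ltac:(lra)) as H41.
  assert (HG1 : Cmod (G z1) <= A).
  { pose proof (Cmod_sub_ge (G z1) (G z0)). unfold A. lra. }
  assert (HF2 : Cmod (F z2) <= A).
  { pose proof (Cmod_sub_ge (F z2) (F z0)). unfold A. lra. }
  set (D := Cmod (z1 - z2)) in *. assert (HD : 0 <= D) by apply Cmod_ge_0.
  set (X := (F z1 - F z2 - l * (z1 - z2))%C) in *.
  set (Y := (G z1 - G z2 - m * (z1 - z2))%C) in *.
  replace (F z1 * G z1 - F z2 * G z2 - (l * G z0 + F z0 * m) * (z1 - z2))%C
    with (X * G z1 + l * (z1 - z2) * (G z1 - G z0)
          + (F z2 * Y + m * (z1 - z2) * (F z2 - F z0)))%C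
    by (unfold X, Y; ring).
  eapply Rle_trans; [apply Cmod_triangle|].
  eapply Rle_trans; [apply Rplus_le_compat; apply Cmod_triangle|].
  rewrite !Cmod_mult. fold D.
  assert (K1 : Cmod X * Cmod (G z1) <= e' * D * A)
    by (apply Rmult_le_compat; auto using Cmod_ge_0).
  assert (K2 : Cmod (F z2) * Cmod Y <= A * (e' * D))
    by (apply Rmult_le_compat; auto using Cmod_ge_0).
  assert (K3 : Cmod l * D * Cmod (G z1 - G z0) <= A * D * e').
  { apply Rmult_le_compat; auto using Cmod_ge_0, Rmult_le_pos; [|lra].
    apply Rmult_le_compat_r; [exact HD | unfold A; lra]. }
  assert (K4 : Cmod m * D * Cmod (F z2 - F z0) <= A * D * e').
  { apply Rmult_le_compat; auto using Cmod_ge_0, Rmult_le_pos; [|lra].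
    apply Rmult_le_compat_r; [exact HD | unfold A; lra]. }
  assert (4 * A * e' * D <= e * D) by (apply Rmult_le_compat_r; assumption).
  lra.
Qed.

Lemma strict_derive_inv F z0 l :
  F z0 <> RtoC 0 -> is_strict_derive F z0 l ->
  is_strict_derive (fun z => / F z)%C z0 (- l / (F z0 * F z0))%C.
Proof.
  intros HF0 HF e He.
  set (A := Cmod (F z0)). assert (HA : 0 < A) by (apply Cmod_gt_0; exact HF0).
  pose proof (Cmod_ge_0 l) as Pl. set (L := Cmod l) in *.
  (* [B] dominates both error terms of the difference quotient of [1 / F] *)
  set (B := 4 / (A * A) + 10 * L / (A * A * A)).
  assert (HA2 : 0 < / A) by (apply Rinv_0_lt_compat; exact HA).
  assert (HB : 0 < B).
  { unfold B. apply Rplus_lt_le_0_compat.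
    - apply Rdiv_lt_0_compat; nra.
    - apply Rmult_le_pos; [lra|]. apply Rlt_le, Rinv_0_lt_compat.
      repeat apply Rmult_lt_0_compat; assumption. }
  set (e' := Rmin (A / 2) (e / B)).
  assert (He' : 0 < e').
  { apply Rmin_pos; [lra|]. apply Rdiv_lt_0_compat; assumption. }
  assert (He1 : e' <= A / 2) by apply Rmin_l.
  assert (HeB : B * e' <= e).
  { assert (Hx : e' <= e / B) by apply Rmin_r.
    apply Rmult_le_compat_l with (r := B) in Hx; [|lra].
    replace (B * (e / B)) with e in Hx by (field; lra). exact Hx. }
  destruct (HF e' He') as (d1 & Hd1 & H1).
  destruct (strict_derive_continuous F z0 l HF e' He') as (d3 & Hd3 & H3).
  exists (Rmin d1 d3). split; [apply Rmin_pos; assumption|].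
  intros z1 z2 Hz1 Hz2. pose proof (Rmin_l d1 d3). pose proof (Rmin_r d1 d3).
  specialize (H1 z1 z2 ltac:(lra) ltac:(lra)).
  pose proof (H3 z1 ltac:(lra)) as G1. pose proof (H3 z2 ltac:(lra)) as G2.
  assert (N1 : A / 2 <= Cmod (F z1)).
  { pose proof (Cmod_sub_ge (F z0) (F z1)) as T. rewrite Cmod_sub_sym in T. fold A in T. lra. }
  assert (N2 : A / 2 <= Cmod (F z2)).
  { pose proof (Cmod_sub_ge (F z0) (F z2)) as T. rewrite Cmod_sub_sym in T. fold A in T. lra. }
  assert (Z1 : F z1 <> RtoC 0) by (apply Cmod_gt_0; lra).
  assert (Z2 : F z2 <> RtoC 0) by (apply Cmod_gt_0; lra).
  assert (I1 : Cmod (/ F z1) <= 2 / A).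
  { rewrite Cmod_inv by exact Z1. replace (2 / A) with (/ (A / 2)) by (field; lra).
    apply Rinv_le_contravar; lra. }
  assert (I2 : Cmod (/ F z2) <= 2 / A).
  { rewrite Cmod_inv by exact Z2. replace (2 / A) with (/ (A / 2)) by (field; lra).
    apply Rinv_le_contravar; lra. }
  assert (I0 : Cmod (/ F z0) = / A) by (rewrite Cmod_inv by exact HF0; reflexivity).
  set (D := Cmod (z1 - z2)) in *. assert (HD : 0 <= D) by apply Cmod_ge_0.
  set (X := (F z1 - F z2 - l * (z1 - z2))%C) in *.
  replace (/ F z1 - / F z2 - - l / (F z0 * F z0) * (z1 - z2))%C
    with (- (X * (/ F z1 * / F z2)) +
          (l * (z1 - z2) * (/ F z1 * / F z0 * / F z0 * (F z1 - F z0)) +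
           l * (z1 - z2) * (/ F z1 * / F z2 * / F z0 * (F z2 - F z0))))%C
    by (unfold X; field; auto).
  eapply Rle_trans; [apply Cmod_triangle|].
  eapply Rle_trans; [apply Rplus_le_compat_l; apply Cmod_triangle|].
  rewrite Cmod_opp, !Cmod_mult, I0. fold D L.
  assert (P1 := Cmod_ge_0 (/ F z1)). assert (P2 := Cmod_ge_0 (/ F z2)).
  assert (K1 : Cmod X * (Cmod (/ F z1) * Cmod (/ F z2)) <= e' * D * (2 / A * (2 / A))).
  { apply Rmult_le_compat; auto using Cmod_ge_0, Rmult_le_pos.
    apply Rmult_le_compat; auto. }
  assert (HLD : 0 <= L * D) by (apply Rmult_le_pos; assumption).
  assert (K2 : L * D * (Cmod (/ F z1) * / A * / A * Cmod (F z1 - F z0))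
     <= L * D * (2 / A * / A * / A * e')).
  { apply Rmult_le_compat_l; [exact HLD|].
    apply Rmult_le_compat; [| apply Cmod_ge_0 | | lra].
    - repeat apply Rmult_le_pos; lra.
    - apply Rmult_le_compat_r; [lra|]. apply Rmult_le_compat_r; [lra | exact I1]. }
  assert (K3 : L * D * (Cmod (/ F z1) * Cmod (/ F z2) * / A * Cmod (F z2 - F z0))
     <= L * D * (2 / A * (2 / A) * / A * e')).
  { apply Rmult_le_compat_l; [exact HLD|].
    apply Rmult_le_compat; [| apply Cmod_ge_0 | | lra].
    - repeat apply Rmult_le_pos; lra.
    - apply Rmult_le_compat_r; [lra|]. apply Rmult_le_compat; assumption. }
  assert (HBe : B * e' * D <= e * D) by (apply Rmult_le_compat_r; assumption).
  assert (Hsum : e' * D * (2 / A * (2 / A)) + (L * D * (2 / A * / A * / A * e')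
            + L * D * (2 / A * (2 / A) * / A * e')) <= B * e' * D).
  { assert (Hx : 0 <= L * D * e' * (/ A * / A * / A)).
    { apply Rmult_le_pos; [nra|]. repeat apply Rmult_le_pos; lra. }
    unfold B. replace (4 / (A * A) + 10 * L / (A * A * A))
      with (4 * (/ A * / A) + 10 * L * (/ A * / A * / A)) by (field; lra).
    unfold Rdiv. lra. }
  lra.
Qed.

Lemma holomorphic_const U c : holomorphic_on U (fun _ => c).
Proof. intros z _. exists (RtoC 0). apply strict_derive_const. Qed.

Lemma holomorphic_id U : holomorphic_on U (fun z => z).
Proof. intros z _. exists (RtoC 1). apply strict_derive_id. Qed.

Lemma holomorphic_plus U F G :
  holomorphic_on U F -> holomorphic_on U G -> holomorphic_on U (fun z => F z + G z)%C.
Proof.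
  intros HF HG z Hz. destruct (HF z Hz) as [l Hl]. destruct (HG z Hz) as [m Hm].
  eexists. apply strict_derive_plus; eassumption.
Qed.

Lemma holomorphic_mult U F G :
  holomorphic_on U F -> holomorphic_on U G -> holomorphic_on U (fun z => F z * G z)%C.
Proof.
  intros HF HG z Hz. destruct (HF z Hz) as [l Hl]. destruct (HG z Hz) as [m Hm].
  eexists. apply strict_derive_mult; eassumption.
Qed.

Lemma holomorphic_inv U F :
  (forall z, U z -> F z <> RtoC 0) -> holomorphic_on U F -> holomorphic_on U (fun z => / F z)%C.
Proof.
  intros H0 HF z Hz. destruct (HF z Hz) as [l Hl].
  eexists. apply strict_derive_inv; auto; eassumption.
Qed.

Lemma holomorphic_pow U n : holomorphic_on U (fun z => z ^ n)%C.
Proof.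
  induction n; [apply (holomorphic_const U (RtoC 1))|].
  apply (holomorphic_mult U (fun z => z) (fun z => z ^ n)%C); [apply holomorphic_id | exact IHn].
Qed.

Lemma holomorphic_cpoly U a N : holomorphic_on U (cpoly a N).
Proof.
  unfold cpoly. induction N; simpl.
  - apply (holomorphic_mult U (fun _ => a 0%nat) (fun z => z ^ 0)%C); [apply holomorphic_const | apply holomorphic_pow].
  - apply (holomorphic_plus U (fun z => csum (fun k => a k * z ^ k)%C N)
             (fun z => a (S N) * z ^ S N)%C); [exact IHN|].
    apply (holomorphic_mult U (fun _ => a (S N)) (fun z => z ^ S N)%C);
      [apply holomorphic_const | apply holomorphic_pow].
Qed.

Lemma holomorphic_sub (U V : C -> Prop) F :
  (forall z, V z -> U z) -> holomorphic_on U F -> holomorphic_on V F.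
Proof. intros H HF z Hz. apply HF, H, Hz. Qed.

(** * Circle means of holomorphic functions *)

Lemma Cmod_pair_le (a b : R) : Cmod (a, b) <= Rabs a + Rabs b.
Proof.
  replace ((a, b) : C) with (RtoC a + Ci * RtoC b)%C.
  - eapply Rle_trans; [apply Cmod_triangle|].
    rewrite Cmod_mult, Cmod_Ci, !Cmod_R. lra.
  - unfold RtoC, Ci, Cplus, Cmult; simpl. f_equal; ring.
Qed.

(** The chain rule along a real curve, as an estimate on complex increments from
    which the real and the imaginary parts can both be read off. *)
Lemma strict_derive_path F (g1 g2 : R -> R) x l d1 d2 :
  is_strict_derive F (g1 x, g2 x) l -> is_derive g1 x d1 -> is_derive g2 x d2 ->
  forall e, 0 < e -> exists d, 0 < d /\ forall h, Rabs h < d ->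
    Cmod (F (g1 (x + h), g2 (x + h)) - F (g1 x, g2 x) - RtoC h * (l * (d1, d2))%C) <= e * Rabs h.
Proof.
  intros HF H1 H2 e He.
  assert (Hinc : forall g dg, is_derive g x dg -> forall n, 0 < n -> exists d, 0 < d /\
    forall h, Rabs h < d -> Rabs (g (x + h) - g x - h * dg) <= n * Rabs h).
  { intros g dg Hg n Hn. apply is_derive_Reals in Hg. destruct (Hg n Hn) as [d Hd].
    exists d. split; [apply cond_pos|]. intros h Hh.
    destruct (Req_dec h 0) as [->|Hne].
    - rewrite Rplus_0_r, Rabs_R0. replace (g x - g x - 0 * dg) with 0 by ring.
      rewrite Rabs_R0. lra.
    - specialize (Hd h Hne Hh).
      replace (g (x + h) - g x - h * dg) with (((g (x + h) - g x) / h - dg) * h) by (field; exact Hne).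
      rewrite Rabs_mult. apply Rmult_le_compat_r; [apply Rabs_pos | lra]. }
  pose proof (Cmod_ge_0 l) as Pl.
  set (v := ((d1, d2) : C)). set (B := Cmod v + 1).
  assert (HB : 1 <= B) by (pose proof (Cmod_ge_0 v); unfold B; lra).
  set (n := Rmin (1 / 2) (e / (4 * (Cmod l + 1)))).
  assert (Hn : 0 < n).
  { apply Rmin_pos; [lra|]. apply Rdiv_lt_0_compat; lra. }
  assert (Hn1 : n <= 1 / 2) by apply Rmin_l.
  assert (Hn2 : 2 * n * Cmod l <= e / 2).
  { assert (Hx : n <= e / (4 * (Cmod l + 1))) by apply Rmin_r.
    apply Rmult_le_compat_r with (r := 4 * (Cmod l + 1)) in Hx; [|lra].
    replace (e / (4 * (Cmod l + 1)) * (4 * (Cmod l + 1))) with e in Hx by (field; lra).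
    nra. }
  destruct (Hinc _ _ H1 n Hn) as (r1 & Hr1 & I1).
  destruct (Hinc _ _ H2 n Hn) as (r2 & Hr2 & I2).
  assert (He' : 0 < e / (2 * B)) by (apply Rdiv_lt_0_compat; lra).
  destruct (HF _ He') as (r3 & Hr3 & I3).
  exists (Rmin (Rmin r1 r2) (r3 / B)). split.
  { repeat apply Rmin_pos; try assumption. apply Rdiv_lt_0_compat; lra. }
  intros h Hh.
  pose proof (Rmin_l r1 r2). pose proof (Rmin_r r1 r2).
  pose proof (Rmin_l (Rmin r1 r2) (r3 / B)). pose proof (Rmin_r (Rmin r1 r2) (r3 / B)).
  specialize (I1 h ltac:(lra)). specialize (I2 h ltac:(lra)).
  set (z1 := ((g1 (x + h), g2 (x + h)) : C)). set (z2 := ((g1 x, g2 x) : C)).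
  assert (Ha := Rabs_pos h).
  assert (Hd : Cmod (z1 - z2 - RtoC h * v) <= 2 * n * Rabs h).
  { replace (z1 - z2 - RtoC h * v)%C with
      ((g1 (x + h) - g1 x - h * d1, g2 (x + h) - g2 x - h * d2) : C).
    - eapply Rle_trans; [apply Cmod_pair_le|]. lra.
    - unfold z1, z2, v, RtoC, Cminus, Cplus, Copp, Cmult; simpl. f_equal; ring. }
  assert (Hz : Cmod (z1 - z2) <= B * Rabs h).
  { replace (z1 - z2)%C with ((z1 - z2 - RtoC h * v) + RtoC h * v)%C by ring.
    eapply Rle_trans; [apply Cmod_triangle|]. rewrite Cmod_mult, Cmod_R.
    assert (2 * n * Rabs h <= 1 * Rabs h) by (apply Rmult_le_compat_r; lra).
    unfold B. lra. }
  assert (Hz3 : Cmod (z1 - z2) < r3).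
  { eapply Rle_lt_trans; [exact Hz|].
    apply Rlt_le_trans with (B * (r3 / B)); [apply Rmult_lt_compat_l; lra|].
    right. field. lra. }
  fold z2 in I3. specialize (I3 z1 z2 Hz3).
  replace (z2 - z2)%C with (RtoC 0) in I3 by ring. rewrite Cmod_0 in I3. specialize (I3 Hr3).
  replace (F z1 - F z2 - RtoC h * (l * v))%C
    with ((F z1 - F z2 - l * (z1 - z2)) + l * (z1 - z2 - RtoC h * v))%C by ring.
  eapply Rle_trans; [apply Cmod_triangle|]. rewrite Cmod_mult.
  assert (K1 : e / (2 * B) * Cmod (z1 - z2) <= e / (2 * B) * (B * Rabs h)).
  { apply Rmult_le_compat_l; lra. }
  replace (e / (2 * B) * (B * Rabs h)) with (e / 2 * Rabs h) in K1 by (field; lra).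
  assert (K2 : Cmod l * Cmod (z1 - z2 - RtoC h * v) <= Cmod l * (2 * n * Rabs h)).
  { apply Rmult_le_compat_l; assumption. }
  assert (K3 : 2 * n * Cmod l * Rabs h <= e / 2 * Rabs h) by (apply Rmult_le_compat_r; assumption).
  lra.
Qed.

Lemma is_derive_of_increment (g : R -> R) x dg :
  (forall e, 0 < e -> exists d, 0 < d /\ forall h, Rabs h < d ->
     Rabs (g (x + h) - g x - h * dg) <= e * Rabs h) -> is_derive g x dg.
Proof.
  intros H. apply is_derive_Reals. intros e He.
  destruct (H (e / 2) ltac:(lra)) as (d & Hd & Hg).
  exists (mkposreal d Hd). intros h Hne Hh. specialize (Hg h Hh).
  replace ((g (x + h) - g x) / h - dg) with ((g (x + h) - g x - h * dg) / h) by (field; exact Hne).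
  assert (Hp : 0 < Rabs h) by (apply Rabs_pos_lt; exact Hne).
  rewrite Rabs_div by exact Hne.
  apply Rmult_lt_reg_r with (Rabs h); [exact Hp|].
  replace (Rabs (g (x + h) - g x - h * dg) / Rabs h * Rabs h)
    with (Rabs (g (x + h) - g x - h * dg)) by (field; lra).
  nra.
Qed.

Lemma is_derive_Re_path F (g1 g2 : R -> R) x l d1 d2 :
  is_strict_derive F (g1 x, g2 x) l -> is_derive g1 x d1 -> is_derive g2 x d2 ->
  is_derive (fun u => Re (F (g1 u, g2 u))) x (Re (l * (d1, d2))%C).
Proof.
  intros HF H1 H2. apply is_derive_of_increment. intros e He.
  destruct (strict_derive_path F g1 g2 x l d1 d2 HF H1 H2 e He) as (d & Hd & H).
  exists d. split; [exact Hd|]. intros h Hh.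
  eapply Rle_trans; [|apply (H h Hh)]. eapply Rle_trans; [|apply Rabs_Re_le].
  right. f_equal. unfold Cminus. rewrite !re_plus, !re_opp, re_scal_l. reflexivity.
Qed.

Lemma is_derive_Im_path F (g1 g2 : R -> R) x l d1 d2 :
  is_strict_derive F (g1 x, g2 x) l -> is_derive g1 x d1 -> is_derive g2 x d2 ->
  is_derive (fun u => Im (F (g1 u, g2 u))) x (Im (l * (d1, d2))%C).
Proof.
  intros HF H1 H2. apply is_derive_of_increment. intros e He.
  destruct (strict_derive_path F g1 g2 x l d1 d2 HF H1 H2 e He) as (d & Hd & H).
  exists d. split; [exact Hd|]. intros h Hh.
  eapply Rle_trans; [|apply (H h Hh)]. eapply Rle_trans; [|apply Rabs_Im_le].
  right. f_equal. unfold Cminus. rewrite !im_plus, !im_opp, im_scal_l. reflexivity.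
Qed.

Definition punctured_disk (z : C) : Prop := 0 < Cmod z < 1.

Definition polar (rho t : R) : C := (rho * cos t, rho * sin t).

Definition is_circle_integral (F : C -> C) (rho I : R) : Prop :=
  is_RInt (fun t => Re (F (polar rho t))) 0 (2 * PI) I.

Lemma Cmod_polar rho t : 0 <= rho -> Cmod (polar rho t) = rho.
Proof.
  intros Hr. unfold polar, Cmod. simpl fst. simpl snd.
  replace ((rho * cos t) ^ 2 + (rho * sin t) ^ 2) with (rho ^ 2 * (Rsqr (sin t) + Rsqr (cos t)))
    by (unfold Rsqr; ring).
  rewrite sin2_cos2, Rmult_1_r. rewrite <- Rsqr_pow2. apply sqrt_Rsqr. exact Hr.
Qed.

Lemma polar_scal rho t : polar rho t = (RtoC rho * polar 1 t)%C.
Proof. unfold polar, RtoC, Cmult; simpl. f_equal; ring. Qed.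

Lemma is_derive_polar_r t rho :
  is_derive (fun r => r * cos t) rho (cos t) /\ is_derive (fun r => r * sin t) rho (sin t).
Proof. split; auto_derive; auto; ring. Qed.

Lemma is_derive_polar_t t rho :
  is_derive (fun s => rho * cos s) t (- rho * sin t) /\
  is_derive (fun s => rho * sin s) t (rho * cos t).
Proof. split; auto_derive; auto; ring. Qed.

(** Take [w] close to [z], and [z] close to [z0]: both [D z * (w - z)] and
    [D z0 * (w - z)] approximate [F w - F z] up to a small multiple of [|w - z|]. *)
Lemma strict_derive_derivative_continuous F (D : C -> C) z0 d0 :
  0 < d0 -> (forall z, Cmod (z - z0) < d0 -> is_strict_derive F z (D z)) ->
  forall e, 0 < e -> exists d, 0 < d /\ forall z, Cmod (z - z0) < d -> Cmod (D z - D z0) < e.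
Proof.
  intros Hd0 HD e He.
  assert (H0 : is_strict_derive F z0 (D z0)).
  { apply HD. replace (z0 - z0)%C with (RtoC 0) by ring. rewrite Cmod_0. exact Hd0. }
  destruct (H0 (e / 4) ltac:(lra)) as (d & Hd & Hs).
  exists (Rmin d0 d). split; [apply Rmin_pos; assumption|]. intros z Hz.
  pose proof (Rmin_l d0 d). pose proof (Rmin_r d0 d).
  destruct (HD z ltac:(lra) (e / 4) ltac:(lra)) as (d1 & Hd1 & Hs1).
  set (h := Rmin (d1 / 2) ((d - Cmod (z - z0)) / 2)).
  assert (Hh : 0 < h) by (apply Rmin_pos; lra).
  assert (h <= d1 / 2) by apply Rmin_l.
  assert (h <= (d - Cmod (z - z0)) / 2) by apply Rmin_r.
  assert (Hw : Cmod ((z + RtoC h) - z) = h).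
  { replace (z + RtoC h - z)%C with (RtoC h) by ring. rewrite Cmod_R, Rabs_pos_eq; lra. }
  specialize (Hs1 (z + RtoC h)%C z ltac:(lra)).
  replace (z - z)%C with (RtoC 0) in Hs1 by ring. rewrite Cmod_0 in Hs1. specialize (Hs1 Hd1).
  assert (Hw0 : Cmod (z + RtoC h - z0) < d).
  { replace (z + RtoC h - z0)%C with ((z + RtoC h - z) + (z - z0))%C by ring.
    eapply Rle_lt_trans; [apply Cmod_triangle|]. lra. }
  specialize (Hs (z + RtoC h)%C z Hw0 ltac:(lra)).
  rewrite Hw in Hs, Hs1. replace (z + RtoC h - z)%C with (RtoC h) in Hs, Hs1 by ring.
  set (X := (F (z + RtoC h) - F z)%C) in *.
  assert (Hm : Cmod (D z - D z0) * h <= (e / 2) * h).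
  { replace h with (Cmod (RtoC h)) at 1 by (rewrite Cmod_R, Rabs_pos_eq; lra).
    rewrite <- Cmod_mult.
    replace ((D z - D z0) * RtoC h)%C with ((X - D z0 * RtoC h) - (X - D z * RtoC h))%C by ring.
    eapply Rle_trans; [apply Cmod_sub_le|]. lra. }
  apply Rmult_le_reg_r in Hm; lra.
Qed.

Lemma continuous_at_disc (g : C -> R) z0 :
  (forall e, 0 < e -> exists d, 0 < d /\ forall z, Cmod (z - z0) < d -> Rabs (g z - g z0) < e) ->
  continuous (T := C_UniformSpace) g z0.
Proof.
  intros H. apply filterlim_locally. intros e.
  apply (proj2 (locally_disc z0 (fun z => ball (g z0) e (g z)))).
  destruct (H e (cond_pos e)) as (d & Hd & Hz). exists d. split; [exact Hd|].
  intros z Hz'. apply Hz. exact Hz'.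
Qed.

(** Along a circle, the radial derivative of the real part of [F] is the
    derivative in the angle of its imaginary part divided by the radius (the
    Cauchy-Riemann equations in polar form), and the latter integrates to zero
    over a full turn. *)
Lemma circle_integral_constant F :
  holomorphic_on punctured_disk F -> exists I, forall rho, 0 < rho < 1 -> is_circle_integral F rho I.
Proof.
  intros HF.
  set (D := fun z => epsilon (inhabits (RtoC 0)) (fun l => is_strict_derive F z l)).
  assert (HD : forall z, punctured_disk z -> is_strict_derive F z (D z)).
  { intros z Hz. apply epsilon_spec. exact (HF z Hz). }
  assert (HDr : forall rho t, 0 < rho < 1 -> is_strict_derive F (polar rho t) (D (polar rho t))).
  { intros rho t Hr. apply HD. unfold punctured_disk. rewrite Cmod_polar; lra. }
  set (f := fun rho t => Re (F (polar rho t))).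
  set (df := fun rho t => Re (D (polar rho t) * polar 1 t)%C).
  assert (Hdr : forall rho t, 0 < rho < 1 -> is_derive (fun r => f r t) rho (df rho t)).
  { intros rho t Hr. destruct (is_derive_polar_r t rho) as [P1 P2].
    pose proof (is_derive_Re_path F _ _ rho _ _ _ (HDr rho t Hr) P1 P2) as Hp.
    unfold df. rewrite (polar_scal 1 t).
    replace (RtoC 1 * polar 1 t)%C with ((cos t, sin t) : C); [exact Hp|].
    unfold polar, RtoC, Cmult; simpl. f_equal; ring. }
  assert (Hdt : forall rho t, 0 < rho < 1 ->
     is_derive (fun s => Im (F (polar rho s))) t (rho * df rho t)).
  { intros rho t Hr. destruct (is_derive_polar_t t rho) as [P1 P2].
    pose proof (is_derive_Im_path F _ _ t _ _ _ (HDr rho t Hr) P1 P2) as Hp.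
    replace (rho * df rho t) with (Im (Cmult (D (polar rho t)) (- rho * sin t, rho * cos t)));
      [exact Hp|].
    unfold df, polar, Re, Im, Cmult; simpl. ring. }
  assert (Hdt' : forall rho t, 0 < rho < 1 -> ex_derive (fun s => f rho s) t).
  { intros rho t Hr. destruct (is_derive_polar_t t rho) as [P1 P2].
    eexists. exact (is_derive_Re_path F _ _ t _ _ _ (HDr rho t Hr) P1 P2). }
  assert (HcD : forall rho t, 0 < rho < 1 -> forall e, 0 < e -> exists d, 0 < d /\
     forall z, Cmod (z - polar rho t) < d -> Cmod (D z - D (polar rho t)) < e).
  { intros rho t Hr. apply strict_derive_derivative_continuous with (F := F) (d0 := Rmin rho (1 - rho)).
    - apply Rmin_pos; lra.
    - intros z Hz. apply HD.
      pose proof (Rmin_l rho (1 - rho)). pose proof (Rmin_r rho (1 - rho)).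
      pose proof (Cmod_polar rho t ltac:(lra)).
      pose proof (Cmod_sub_ge z (polar rho t)).
      pose proof (Cmod_sub_ge (polar rho t) z) as Hx. rewrite Cmod_sub_sym in Hx.
      split; lra. }
  assert (Hc2 : forall rho t, 0 < rho < 1 ->
     continuous (T := prod_UniformSpace R_UniformSpace R_UniformSpace)
       (fun p : R * R => df (fst p) (snd p)) (rho, t)).
  { intros rho t Hr.
    assert (Hcos : continuous (T := prod_UniformSpace R_UniformSpace R_UniformSpace)
              (fun p : R * R => cos (snd p)) (rho, t)).
    { apply (continuous_comp snd cos); [apply continuous_snd|].
      apply (ex_derive_continuous (V := R_NormedModule) cos). auto_derive. exact I. }
    assert (Hsin : continuous (T := prod_UniformSpace R_UniformSpace R_UniformSpace)
              (fun p : R * R => sin (snd p)) (rho, t)).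
    { apply (continuous_comp snd sin); [apply continuous_snd|].
      apply (ex_derive_continuous (V := R_NormedModule) sin). auto_derive. exact I. }
    assert (HX : continuous (T := prod_UniformSpace R_UniformSpace R_UniformSpace)
              (fun p : R * R => fst p * cos (snd p)) (rho, t)).
    { apply (continuous_mult (K := R_AbsRing) fst (fun p : R * R => cos (snd p)));
        [apply continuous_fst | exact Hcos]. }
    assert (HY : continuous (T := prod_UniformSpace R_UniformSpace R_UniformSpace)
              (fun p : R * R => fst p * sin (snd p)) (rho, t)).
    { apply (continuous_mult (K := R_AbsRing) fst (fun p : R * R => sin (snd p)));
        [apply continuous_fst | exact Hsin]. }
    assert (HRe : continuous (T := prod_UniformSpace R_UniformSpace R_UniformSpace)
              (fun p : R * R => Re (D (polar (fst p) (snd p)))) (rho, t)).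
    { apply (continuous_comp_2 (fun p : R * R => fst p * cos (snd p))
               (fun p : R * R => fst p * sin (snd p)) (fun a b => Re (D (a, b)))
               (rho, t) HX HY).
      apply (continuous_at_disc (fun p : C => Re (D (fst p, snd p))) (polar rho t)).
      intros e He. destruct (HcD rho t Hr e He) as (d & Hd & Hz).
      exists d. split; [exact Hd|]. intros [a b] Hab. specialize (Hz (a, b) Hab).
      eapply Rle_lt_trans; [|exact Hz]. eapply Rle_trans; [|apply Rabs_Re_le].
      right. f_equal. }
    assert (HIm : continuous (T := prod_UniformSpace R_UniformSpace R_UniformSpace)
              (fun p : R * R => Im (D (polar (fst p) (snd p)))) (rho, t)).
    { apply (continuous_comp_2 (fun p : R * R => fst p * cos (snd p))
               (fun p : R * R => fst p * sin (snd p)) (fun a b => Im (D (a, b)))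
               (rho, t) HX HY).
      apply (continuous_at_disc (fun p : C => Im (D (fst p, snd p))) (polar rho t)).
      intros e He. destruct (HcD rho t Hr e He) as (d & Hd & Hz).
      exists d. split; [exact Hd|]. intros [a b] Hab. specialize (Hz (a, b) Hab).
      eapply Rle_lt_trans; [|exact Hz]. eapply Rle_trans; [|apply Rabs_Im_le].
      right. f_equal. }
    apply continuous_ext with (f := fun p : R * R =>
       minus (mult (Re (D (polar (fst p) (snd p)))) (cos (snd p)))
             (mult (Im (D (polar (fst p) (snd p)))) (sin (snd p)))).
    - intros [a b]. unfold df. simpl fst. simpl snd. rewrite re_mult.
      replace (Re (polar 1 b)) with (cos b) by (unfold polar, Re; simpl; ring).
      replace (Im (polar 1 b)) with (sin b) by (unfold polar, Im; simpl; ring).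
      reflexivity.
    - apply (continuous_minus (V := R_NormedModule)).
      + apply (continuous_mult (K := R_AbsRing)); [exact HRe | exact Hcos].
      + apply (continuous_mult (K := R_AbsRing)); [exact HIm | exact Hsin]. }
  assert (Hint : forall rho, 0 < rho < 1 -> ex_RInt (fun t => f rho t) 0 (2 * PI)).
  { intros rho Hr. apply (ex_RInt_continuous (V := R_CompleteNormedModule)).
    intros t _. apply (ex_derive_continuous (V := R_NormedModule) (fun s => f rho s)).
    apply Hdt', Hr. }
  assert (Hloc : forall rho, 0 < rho < 1 -> locally rho (fun r => 0 < r < 1)).
  { intros rho Hr. apply (open_and _ _ (open_gt 0) (open_lt 1)). exact Hr. }
  assert (Hder : forall rho, 0 < rho < 1 ->
     is_derive (fun r => RInt (fun t => f r t) 0 (2 * PI)) rho 0).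
  { intros rho Hr.
    cut (RInt (fun t => Derive (fun u => f u t) rho) 0 (2 * PI) = 0).
    - intros Hz. refine (eq_ind _ (is_derive _ rho) _ _ Hz). apply (is_derive_RInt_param f).
      + eapply filter_imp; [|exact (Hloc rho Hr)]. intros r Hr' t _.
        eexists. apply Hdr, Hr'.
      + intros t _. apply continuity_2d_pt_ext_loc with (f := df).
        * destruct (Hloc rho Hr) as [e He]. exists e. intros u v Hu _.
          symmetry. apply is_derive_unique. apply Hdr. apply He. exact Hu.
        * apply continuity_2d_pt_filterlim. apply (Hc2 rho t Hr).
      + eapply filter_imp; [|exact (Hloc rho Hr)]. exact Hint.
    - apply (is_RInt_unique (V := R_CompleteNormedModule)).
      apply is_RInt_ext with (f := fun t => scal (/ rho) (rho * df rho t)).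
      { intros t _. simpl.
        replace (Derive (fun u : R => f u t) rho) with (df rho t)
          by (symmetry; apply is_derive_unique, Hdr, Hr).
        unfold scal; simpl; unfold mult; simpl. field. lra. }
      cut (scal (/ rho) (minus (Im (F (polar rho (2 * PI)))) (Im (F (polar rho 0)))) = 0).
      + intros Hz. refine (eq_ind _ (is_RInt _ 0 (2 * PI)) _ _ Hz). apply (is_RInt_scal (V := R_NormedModule)).
        apply (is_RInt_derive (V := R_CompleteNormedModule) (fun s => Im (F (polar rho s)))).
        * intros t _. apply Hdt, Hr.
        * intros t _.
          apply (continuous_scal_r (K := R_AbsRing) (V := R_NormedModule) rho (fun s => df rho s)).
          apply (continuous_comp_2 (fun _ : R => rho) (fun s : R => s) df t);
            [apply continuous_const | apply continuous_id | apply Hc2, Hr].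
      + unfold polar. rewrite cos_2PI, sin_2PI, cos_0, sin_0.
        unfold minus, plus, opp, scal, mult; simpl; unfold mult; simpl. ring. }
  exists (RInt (fun t => f (1 / 2) t) 0 (2 * PI)). intros rho Hr.
  assert (Heq : RInt (fun t => f (1 / 2) t) 0 (2 * PI) = RInt (fun t => f rho t) 0 (2 * PI)).
  { destruct (Rtotal_order rho (1 / 2)) as [Hlt|[->|Hgt]]; [|reflexivity|].
    - symmetry. apply (eq_is_derive (fun r => RInt (fun t => f r t) 0 (2 * PI))); [|exact Hlt].
      intros r Hr'. apply Hder. lra.
    - apply (eq_is_derive (fun r => RInt (fun t => f r t) 0 (2 * PI))); [|exact Hgt].
      intros r Hr'. apply Hder. lra. }
  rewrite Heq. apply (RInt_correct (V := R_CompleteNormedModule)). apply Hint, Hr.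
Qed.

Lemma circle_integral_ext F G rho I :
  (forall t, F (polar rho t) = G (polar rho t)) -> is_circle_integral F rho I -> is_circle_integral G rho I.
Proof. intros H HF. eapply is_RInt_ext; [|exact HF]. intros t _. simpl. now rewrite H. Qed.

Lemma circle_integral_plus F G rho I J :
  is_circle_integral F rho I -> is_circle_integral G rho J -> is_circle_integral (fun z => F z + G z)%C rho (I + J).
Proof.
  intros HF HG. eapply is_RInt_ext; [|exact (is_RInt_plus _ _ _ _ _ _ HF HG)].
  intros t _. cbv beta. rewrite re_plus. reflexivity.
Qed.

Lemma circle_integral_unique F rho I J :
  is_circle_integral F rho I -> is_circle_integral F rho J -> I = J.
Proof.
  intros HI HJ. rewrite <- (is_RInt_unique (V := R_CompleteNormedModule) _ _ _ _ HI).
  apply (is_RInt_unique (V := R_CompleteNormedModule)). exact HJ.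
Qed.

Lemma polar_neq_0 rho t : 0 < rho -> polar rho t <> RtoC 0.
Proof. intros Hr. apply Cmod_gt_0. rewrite Cmod_polar; lra. Qed.

Lemma holomorphic_laurent c E n :
  holomorphic_on in_disk E -> holomorphic_on punctured_disk (fun z => c * (E z * / z ^ n))%C.
Proof.
  intros HE. apply (holomorphic_mult _ (fun _ => c)); [apply holomorphic_const|].
  apply (holomorphic_mult _ E).
  - eapply holomorphic_sub; [|exact HE]. intros z Hz. apply Hz.
  - apply holomorphic_inv; [|apply holomorphic_pow]. intros z Hz. apply Cpow_nz, Cmod_gt_0, Hz.
Qed.

(** The circles may shrink to the origin, where the integrand tends to zero. *)
Lemma circle_integral_eq_0_of_bound F I K d :
  0 <= K -> 0 < d -> (forall rho, 0 < rho < 1 -> is_circle_integral F rho I) ->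
  (forall z, 0 < Cmod z < d -> Cmod (F z) <= K * Cmod z) -> I = 0.
Proof.
  intros HK Hd HI HF.
  assert (Hb : forall rho, 0 < rho < Rmin 1 d -> Rabs I <= 2 * PI * K * rho).
  { intros rho Hr. pose proof (Rmin_l 1 d). pose proof (Rmin_r 1 d).
    assert (HP := PI_RGT_0).
    assert (Hc : forall c, is_RInt (fun _ => c) 0 (2 * PI) (2 * PI * c)).
    { intros c. replace (2 * PI * c) with (scal (2 * PI - 0) c).
      - apply (is_RInt_const (V := R_NormedModule)).
      - unfold scal; simpl; unfold mult; simpl. ring. }
    assert (HIr := HI rho ltac:(lra)).
    assert (Hp : forall t, Rabs (Re (F (polar rho t))) <= K * rho).
    { intros t. eapply Rle_trans; [apply Rabs_Re_le|].
      rewrite <- (Cmod_polar rho t) at 2 by lra. apply HF. rewrite Cmod_polar; lra. }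
    apply Rabs_le. split.
    - replace (- (2 * PI * K * rho)) with (2 * PI * - (K * rho)) by ring.
      eapply is_RInt_le; [| apply Hc | exact HIr |]; [lra|]. intros t _.
      specialize (Hp t). apply Rabs_le_between in Hp. lra.
    - replace (2 * PI * K * rho) with (2 * PI * (K * rho)) by ring.
      eapply is_RInt_le; [| exact HIr | apply Hc |]; [lra|]. intros t _.
      specialize (Hp t). apply Rabs_le_between in Hp. lra. }
  destruct (Req_dec I 0) as [H0|H0]; [exact H0|exfalso].
  assert (Hp : 0 < Rabs I) by (apply Rabs_pos_lt; exact H0).
  assert (HP := PI_RGT_0).
  assert (HL : 0 < 2 * PI * K + 1) by (assert (0 <= 2 * PI * K) by (apply Rmult_le_pos; lra); lra).
  set (r := Rmin (Rmin 1 d / 2) (Rabs I / (2 * (2 * PI * K + 1)))).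
  assert (Hm : 0 < Rmin 1 d) by (apply Rmin_pos; lra).
  assert (Hr : 0 < r) by (apply Rmin_pos; [lra | apply Rdiv_lt_0_compat; lra]).
  assert (r <= Rmin 1 d / 2) by apply Rmin_l.
  assert (Hr2 : r <= Rabs I / (2 * (2 * PI * K + 1))) by apply Rmin_r.
  specialize (Hb r ltac:(lra)).
  apply Rmult_le_compat_l with (r := 2 * PI * K + 1) in Hr2; [|lra].
  replace ((2 * PI * K + 1) * (Rabs I / (2 * (2 * PI * K + 1)))) with (Rabs I / 2) in Hr2
    by (field; lra).
  lra.
Qed.

Lemma half_pow_ratio_neq_1 k n : k <> n -> (1 / 2) ^ k <> (1 / 2) ^ n.
Proof.
  intros Hne. destruct (Nat.lt_gt_cases k n) as [Hc _]. destruct (Hc Hne) as [Hlt|Hlt].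
  - apply Rgt_not_eq.
    replace n with (k + S (n - k - 1))%nat by lia. rewrite pow_add.
    assert (0 < (1 / 2) ^ k) by (apply pow_lt; lra).
    assert ((1 / 2) ^ S (n - k - 1) < 1).
    { apply pow_lt_1_compat; [lra | lia]. }
    nra.
  - apply Rlt_not_eq.
    replace k with (n + S (k - n - 1))%nat by lia. rewrite pow_add.
    assert (0 < (1 / 2) ^ n) by (apply pow_lt; lra).
    assert ((1 / 2) ^ S (k - n - 1) < 1).
    { apply pow_lt_1_compat; [lra | lia]. }
    nra.
Qed.

(** The integral over a circle is homogeneous of degree [k - n] in the radius,
    but it does not depend on the radius: for [k <> n] it has to vanish. *)
Lemma circle_integral_monomial c k n rho :
  0 < rho < 1 ->
  is_circle_integral (fun z => c * (z ^ k * / z ^ n))%C rho (if Nat.eq_dec k n then 2 * PI * Re c else 0).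
Proof.
  intros Hr. destruct (Nat.eq_dec k n) as [<-|Hne].
  - apply circle_integral_ext with (F := fun _ => c).
    + intros t. rewrite Cinv_r; [ring|]. apply Cpow_nz, polar_neq_0. lra.
    + replace (2 * PI * Re c) with (scal (2 * PI - 0) (Re c)).
      * apply (is_RInt_const (V := R_NormedModule)).
      * unfold scal; simpl; unfold mult; simpl. ring.
  - destruct (circle_integral_constant (fun z => c * (z ^ k * / z ^ n))%C) as [I HI].
    { apply (holomorphic_laurent c (fun z => z ^ k)%C). apply holomorphic_pow. }
    enough (I = 0) as <- by (apply HI; exact Hr).
    set (s := (1 / 2) ^ k / (1 / 2) ^ n).
    assert (Hk : 0 < (1 / 2) ^ k) by (apply pow_lt; lra).
    assert (Hn : 0 < (1 / 2) ^ n) by (apply pow_lt; lra).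
    assert (Hs : s <> 1).
    { intros Hs. apply (half_pow_ratio_neq_1 k n Hne).
      apply Rmult_eq_reg_r with (/ (1 / 2) ^ n); [|apply Rinv_neq_0_compat; lra].
      rewrite Rinv_r by lra. exact Hs. }
    assert (Hsc : forall t, (c * (polar (1 / 4) t ^ k * / polar (1 / 4) t ^ n))%C =
              (RtoC s * (c * (polar (1 / 2) t ^ k * / polar (1 / 2) t ^ n)))%C).
    { intros t.
      assert (E : polar (1 / 4) t = (RtoC (1 / 2) * polar (1 / 2) t)%C)
        by (unfold polar, RtoC, Cmult; simpl; f_equal; field).
      rewrite E, !Cpow_mult_l, <- !RtoC_pow. unfold s.
      assert (RtoC ((1 / 2) ^ n) <> RtoC 0) by (intros X; apply RtoC_inj in X; lra).
      rewrite RtoC_div by lra. field. split; [|assumption].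
      apply Cpow_nz, polar_neq_0. lra. }
    assert (H4 : is_circle_integral (fun z => c * (z ^ k * / z ^ n))%C (1 / 4) (s * I)).
    { pose proof (is_RInt_scal _ _ _ s _ (HI (1 / 2) ltac:(lra))) as Hx.
      eapply is_RInt_ext; [|exact Hx]. intros t _. cbv beta. rewrite Hsc, re_scal_l. reflexivity. }
    pose proof (circle_integral_unique _ _ _ _ H4 (HI (1 / 4) ltac:(lra))) as Hu.
    assert (Hz : (s - 1) * I = 0) by lra.
    apply Rmult_integral in Hz. destruct Hz as [Hz|Hz]; [exfalso; apply Hs; lra | exact Hz].
Qed.

Lemma circle_integral_cpoly c g N n rho :
  0 < rho < 1 ->
  is_circle_integral (fun z => c * (cpoly g N z * / z ^ n))%C rho
    (if le_dec n N then 2 * PI * Re (c * g n)%C else 0).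
Proof.
  intros Hr. induction N as [|N IH].
  - pose proof (circle_integral_monomial (c * g 0%nat) 0 n rho Hr) as Hm.
    destruct (Nat.eq_dec 0 n) as [<-|Hne]; destruct (le_dec _ 0) as [H|H]; try lia;
      (eapply circle_integral_ext; [|exact Hm]); intros t; unfold cpoly; simpl; ring.
  - pose proof (circle_integral_monomial (c * g (S N)) (S N) n rho Hr) as Hm.
    pose proof (circle_integral_plus _ _ _ _ _ IH Hm) as Hp.
    replace (if le_dec n (S N) then 2 * PI * Re (c * g n)%C else 0) with
      ((if le_dec n N then 2 * PI * Re (c * g n)%C else 0) +
       (if Nat.eq_dec (S N) n then 2 * PI * Re (c * g (S N))%C else 0)).
    + eapply circle_integral_ext; [|exact Hp]. intros t. rewrite cpoly_S. ring.
    + destruct (Nat.eq_dec (S N) n) as [<-|Hne]; destruct (le_dec _ N); destruct (le_dec _ (S N));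
        try lia; lra.
Qed.

(** Cauchy's formula for the Taylor coefficients, for a coefficient that is only
    known through a finite jet at the origin. *)
Lemma circle_integral_coeff Phi g N c n rho :
  holomorphic_on in_disk Phi -> has_jet Phi g N -> (n <= N)%nat -> 0 < rho < 1 ->
  is_circle_integral (fun z => c * (Phi z * / z ^ n))%C rho (2 * PI * Re (c * g n)%C).
Proof.
  intros HP (K & d & HK & Hd & HJ) Hn Hr.
  set (E := fun z => (Phi z + - (1) * cpoly g N z)%C).
  assert (HE : holomorphic_on in_disk E).
  { apply (holomorphic_plus _ Phi (fun z => - (1) * cpoly g N z)%C); [exact HP|].
    apply (holomorphic_mult _ (fun _ => - (1))%C); [apply holomorphic_const | apply holomorphic_cpoly]. }
  destruct (circle_integral_constant (fun z => c * (E z * / z ^ n))%C) as [I HI].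
  { apply holomorphic_laurent, HE. }
  assert (HI0 : I = 0).
  { apply (circle_integral_eq_0_of_bound _ I (Cmod c * K) (Rmin 1 d)) with (3 := HI).
    - apply Rmult_le_pos; [apply Cmod_ge_0 | exact HK].
    - apply Rmin_pos; lra.
    - intros z Hz. pose proof (Rmin_l 1 d). pose proof (Rmin_r 1 d).
      assert (Hz0 : z <> RtoC 0) by (apply Cmod_gt_0; lra).
      rewrite !Cmod_mult, Cmod_inv by (apply Cpow_nz; exact Hz0). rewrite Cmod_pow.
      assert (Hzn : 0 < Cmod z ^ n) by (apply pow_lt; lra).
      specialize (HJ z ltac:(lra)).
      replace (Phi z - cpoly g N z)%C with (E z) in HJ by (unfold E; ring).
      rewrite Rmult_assoc. apply Rmult_le_compat_l; [apply Cmod_ge_0|].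
      apply Rmult_le_reg_r with (Cmod z ^ n); [exact Hzn|].
      rewrite Rmult_assoc, Rinv_l, Rmult_1_r by lra.
      eapply Rle_trans; [exact HJ|]. rewrite Rmult_assoc.
      apply Rmult_le_compat_l; [exact HK|].
      replace (S N) with (S n + (N - n))%nat by lia. rewrite pow_add. simpl.
      assert (Cmod z ^ (N - n) <= 1).
      { rewrite <- (pow1 (N - n)). apply pow_incr. lra. }
      assert (0 <= Cmod z * Cmod z ^ n) by (apply Rmult_le_pos; lra). nra. }
  subst I.
  pose proof (circle_integral_cpoly c g N n rho Hr) as Hc. destruct (le_dec n N); [|lia].
  pose proof (circle_integral_plus _ _ _ _ _ (HI rho Hr) Hc) as Hp.
  rewrite Rplus_0_l in Hp. eapply circle_integral_ext; [|exact Hp]. intros t. unfold E. ring.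
Qed.

Lemma polar_conj_pow rho t k :
  0 < rho -> Cconj (polar rho t ^ k) = (RtoC (rho ^ (2 * k)) * / polar rho t ^ k)%C.
Proof.
  intros Hr. assert (Hz : (polar rho t ^ k <> 0)%C) by (apply Cpow_nz, polar_neq_0; exact Hr).
  replace (RtoC (rho ^ (2 * k))) with (polar rho t ^ k * Cconj (polar rho t ^ k))%C.
  - field. exact Hz.
  - rewrite <- Cmod2_conj, Cmod_pow, Cmod_polar by lra.
    f_equal. rewrite <- pow_mult. f_equal. lia.
Qed.

(** On a circle of radius [rho] the conjugate of [z ^ k] is [rho ^ (2 * k) / z ^ k], so
    the conjugate polynomial is a Laurent polynomial and Cauchy's formula applies
    term by term. *)
Lemma circle_integral_cross Phi g N h m rho :
  holomorphic_on in_disk Phi -> has_jet Phi g N -> (m <= N)%nat -> 0 < rho < 1 ->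
  is_circle_integral (fun z => Phi z * Cconj (cpoly h m z))%C rho
    (2 * PI * sum_f_R0 (fun k => Re (Cconj (h k) * g k)%C * rho ^ (2 * k)) m).
Proof.
  intros HP HJ Hm Hr.
  assert (Hk : forall k, (k <= N)%nat ->
    is_circle_integral (fun z => Phi z * Cconj (h k * z ^ k))%C rho
      (2 * PI * (Re (Cconj (h k) * g k)%C * rho ^ (2 * k)))).
  { intros k Hk.
    pose proof (circle_integral_coeff Phi g N (RtoC (rho ^ (2 * k)) * Cconj (h k)) k rho HP HJ Hk Hr) as Hc.
    replace (Re (Cconj (h k) * g k)%C * rho ^ (2 * k)) with
      (Re (RtoC (rho ^ (2 * k)) * Cconj (h k) * g k)%C).
    - eapply circle_integral_ext; [|exact Hc]. intros t.
      rewrite Cmult_conj, polar_conj_pow by lra. ring.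
    - rewrite <- Cmult_assoc, re_scal_l. ring. }
  induction m as [|m IH].
  - apply (Hk 0%nat). lia.
  - pose proof (circle_integral_plus _ _ _ _ _ (IH ltac:(lia)) (Hk (S m) Hm)) as Hp.
    simpl sum_f_R0. rewrite Rmult_plus_distr_l.
    eapply circle_integral_ext; [|exact Hp]. intros t. rewrite cpoly_S, Cplus_conj. ring.
Qed.

Lemma cpoly_jet g N : has_jet (cpoly g N) g N.
Proof.
  exists 0, 1. repeat split; try lra. intros z _.
  replace (cpoly g N z - cpoly g N z)%C with (RtoC 0) by ring. rewrite Cmod_0. lra.
Qed.

Lemma Re_conj_self (z : C) : Re (Cconj z * z)%C = Cmod z ^ 2.
Proof. rewrite Cmult_comm, <- Cmod2_conj. apply re_RtoC. Qed.

Lemma le_of_pow_lt_1 A B n :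
  0 <= A -> (forall rho, 0 < rho < 1 -> rho ^ n * A <= B) -> A <= B.
Proof.
  intros HA H.
  assert (Hc : continuous (fun x => x ^ n * A) 1).
  { apply (ex_derive_continuous (V := R_NormedModule) (fun x => x ^ n * A)).
    auto_derive. exact I. }
  destruct (Rle_or_lt A B) as [Hle|Hlt]; [exact Hle|exfalso].
  assert (Hd : 0 < A - B) by lra.
  apply filterlim_locally with (eps := mkposreal _ Hd) in Hc.
  destruct Hc as [d Hd']. set (r := Rmax (1 / 2) (1 - d / 2)).
  assert (Hpos := cond_pos d).
  assert (Hr : 1 / 2 <= r) by apply Rmax_l.
  assert (Hr2 : 1 - d / 2 <= r) by apply Rmax_r.
  assert (Hr3 : r < 1) by (apply Rmax_lub_lt; lra).
  assert (Hb : ball 1 d r).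
  { unfold ball; simpl; unfold AbsRing_ball, abs, minus, plus, opp; simpl.
    apply Rabs_def1; lra. }
  specialize (Hd' r Hb). unfold ball in Hd'; simpl in Hd'.
  unfold AbsRing_ball, abs, minus, plus, opp in Hd'; simpl in Hd'.
  rewrite pow1, Rmult_1_l in Hd'. apply Rabs_def2 in Hd'.
  specialize (H r ltac:(lra)). lra.
Qed.

(** Bessel's inequality for the jet of [Phi] on circles of radius [rho]: it comes
    from [0 <= |Phi - Q| ^ 2] with [Q] the jet polynomial, once [|Phi| ^ 2] has been
    replaced by the larger [|H| ^ 2], whose mean is known exactly. *)
Lemma jet_square_sum_le Phi g N h m :
  holomorphic_on in_disk Phi -> has_jet Phi g N ->
  (forall z, in_disk z -> Cmod (Phi z) <= Cmod (cpoly h m z)) ->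
  sum_f_R0 (fun k => Cmod (g k) ^ 2) N <= sum_f_R0 (fun k => Cmod (h k) ^ 2) m.
Proof.
  intros HP HJ Hle.
  assert (Hrho : forall rho, 0 < rho < 1 ->
    sum_f_R0 (fun k => Cmod (g k) ^ 2 * rho ^ (2 * k)) N
    <= sum_f_R0 (fun k => Cmod (h k) ^ 2 * rho ^ (2 * k)) m).
  { intros rho Hr.
    pose proof (circle_integral_cross (cpoly h m) h m h m rho (holomorphic_cpoly _ _ _) (cpoly_jet h m) (le_n m) Hr) as H1.
    pose proof (circle_integral_cross (cpoly g N) g N g N rho (holomorphic_cpoly _ _ _) (cpoly_jet g N) (le_n N) Hr) as H2.
    pose proof (circle_integral_cross Phi g N g N rho HP HJ (le_n N) Hr) as H3.
    pose proof (circle_integral_plus _ _ _ _ _ H1 H2) as H12.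
    pose proof (is_RInt_scal _ _ _ (-2) _ H3) as H3'.
    pose proof (is_RInt_plus _ _ _ _ _ _ H12 H3') as Hs.
    assert (HP0 := PI_RGT_0).
    apply is_RInt_ge_0 in Hs; [| lra |].
    - unfold plus, scal in Hs; simpl in Hs; unfold mult in Hs; simpl in Hs.
      rewrite !(sum_eq (fun k => Re (Cconj (g k) * g k)%C * rho ^ (2 * k))
                      (fun k => Cmod (g k) ^ 2 * rho ^ (2 * k))) in Hs
        by (intros; rewrite Re_conj_self; reflexivity).
      rewrite !(sum_eq (fun k => Re (Cconj (h k) * h k)%C * rho ^ (2 * k))
                      (fun k => Cmod (h k) ^ 2 * rho ^ (2 * k))) in Hs
        by (intros; rewrite Re_conj_self; reflexivity).
      set (X := sum_f_R0 (fun k => Cmod (g k) ^ 2 * rho ^ (2 * k)) N) in *.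
      set (Y := sum_f_R0 (fun k => Cmod (h k) ^ 2 * rho ^ (2 * k)) m) in *.
      apply Rmult_le_reg_l with (2 * PI); [lra|]. lra.
    - intros t _.
      assert (Hd : in_disk (polar rho t)) by (unfold in_disk; rewrite Cmod_polar; lra).
      specialize (Hle _ Hd).
      set (p := Phi (polar rho t)) in *. set (q := cpoly g N (polar rho t)).
      set (w := cpoly h m (polar rho t)) in *.
      assert (Hw : Cmod p ^ 2 <= Cmod w ^ 2).
      { apply pow_incr. split; [apply Cmod_ge_0 | exact Hle]. }
      assert (Hpq : 0 <= Cmod (p - q) ^ 2) by (apply pow_le, Cmod_ge_0).
      change (0 <= Re (w * Cconj w + q * Cconj q)%C + (-2) * Re (p * Cconj q)%C).
      rewrite !Cmod2_alt in *. unfold Cminus in *.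
      rewrite ?re_plus, ?re_opp, ?im_plus, ?im_opp in *.
      rewrite !re_mult, !re_conj, !im_conj. lra. }
  apply le_of_pow_lt_1 with (n := (2 * N)%nat).
  - apply cond_pos_sum. intros. apply pow_le, Cmod_ge_0.
  - intros rho Hr. specialize (Hrho rho Hr).
    eapply Rle_trans; [|eapply Rle_trans; [exact Hrho|]].
    + rewrite scal_sum. apply sum_Rle. intros k Hk.
      apply Rmult_le_compat_l; [apply pow_le, Cmod_ge_0|].
      replace (2 * N)%nat with (2 * k + (2 * N - 2 * k))%nat by lia. rewrite pow_add.
      assert (0 < rho ^ (2 * k)) by (apply pow_lt; lra).
      assert (rho ^ (2 * N - 2 * k) <= 1).
      { rewrite <- (pow1 (2 * N - 2 * k)). apply pow_incr. lra. }
      nra.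
    + apply sum_Rle. intros k Hk.
      assert (rho ^ (2 * k) <= 1).
      { rewrite <- (pow1 (2 * k)). apply pow_incr. lra. }
      assert (0 <= Cmod (h k) ^ 2) by (apply pow_le, Cmod_ge_0). nra.
Qed.

(** Cauchy's formula expresses both coefficients by the same circle integrals; the
    multipliers [1] and [Ci] recover the real and the imaginary part. *)
Lemma jet_unique F a b N n :
  holomorphic_on in_disk F -> has_jet F a N -> has_jet F b N -> (n <= N)%nat -> a n = b n.
Proof.
  intros HF Ha Hb Hn.
  assert (Hc : forall c, Re (c * a n)%C = Re (c * b n)%C).
  { intros c.
    pose proof (circle_integral_coeff F a N c n (1 / 2) HF Ha Hn ltac:(lra)) as H1.
    pose proof (circle_integral_coeff F b N c n (1 / 2) HF Hb Hn ltac:(lra)) as H2.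
    pose proof (circle_integral_unique _ _ _ _ H1 H2) as H. assert (HP := PI_RGT_0).
    apply Rmult_eq_reg_l in H; [exact H | lra]. }
  pose proof (Hc (RtoC 1)) as H1. pose proof (Hc Ci) as H2.
  rewrite !Cmult_1_l in H1. rewrite !(Cmult_comm Ci), !re_mult_Ci in H2.
  destruct (a n), (b n). unfold Re, Im in *; simpl in *. f_equal; lra.
Qed.

(** * From square sums to the majorant series *)

(** Summation by parts. *)
Lemma abel_nonneg d w N :
  (forall n, 0 <= sum_f_R0 d n) -> (forall n, 0 <= w (S n) <= w n) ->
  0 <= sum_f_R0 (fun k => w k * d k) N.
Proof.
  intros Hd Hw.
  (* this lower bound, unlike the claim, passes through the induction *)
  apply Rle_trans with (w N * sum_f_R0 d N).
  - apply Rmult_le_pos; [destruct N as [|N]|apply Hd].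
    + pose proof (Hw 0%nat). lra.
    + apply Hw.
  - induction N as [|N IH]; simpl; [lra|].
    pose proof (Hw N). pose proof (Hd N).
    assert (w (S N) * sum_f_R0 d N <= w N * sum_f_R0 d N) by (apply Rmult_le_compat_r; lra).
    lra.
Qed.

(** The hypothesis says that the partial sums of [x k ^ 2] are dominated by those of
    the sequence [b ^ 2, c ^ 2 * x 1 ^ 2, c ^ 2 * x 2 ^ 2, ...] placed one step to the
    right. Decreasing weights [rho ^ k] preserve this, and the step costs a
    factor [rho]. *)
Lemma shifted_square_sum_weighted x b c rho N :
  x 0%nat = 0 ->
  (forall n, sum_f_R0 (fun k => x k ^ 2) (S n) <= b ^ 2 + c ^ 2 * sum_f_R0 (fun k => x k ^ 2) n) ->
  0 <= rho <= 1 ->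
  sum_f_R0 (fun k => x k ^ 2 * rho ^ k) N * (1 - c ^ 2 * rho) <= rho * b ^ 2.
Proof.
  intros H0 Hx Hr.
  (* the dominating sequence minus [x k ^ 2] *)
  set (d := fun k : nat => match k with
    | O => 0 | S j => c ^ 2 * x j ^ 2 + (if Nat.eq_dec j 0 then b ^ 2 else 0) - x k ^ 2 end).
  assert (Hsum : forall n, sum_f_R0 d (S n) =
    b ^ 2 + c ^ 2 * sum_f_R0 (fun k => x k ^ 2) n - sum_f_R0 (fun k => x k ^ 2) (S n)).
  { induction n as [|n IH].
    - simpl. rewrite H0. ring.
    - rewrite tech5, IH, !tech5. unfold d. destruct (Nat.eq_dec (S n) 0) as [E|_]; [lia|]. ring. }
  assert (Hw : sum_f_R0 (fun k => rho ^ k * d k) (S N) =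
    rho * b ^ 2 + c ^ 2 * rho * sum_f_R0 (fun k => x k ^ 2 * rho ^ k) N
    - sum_f_R0 (fun k => x k ^ 2 * rho ^ k) (S N)).
  { clear Hsum. induction N as [|n IH].
    - simpl. rewrite H0. ring.
    - rewrite tech5, IH, !tech5. unfold d. destruct (Nat.eq_dec (S n) 0) as [E|_]; [lia|].
      simpl. ring. }
  assert (Hp : 0 <= sum_f_R0 (fun k => rho ^ k * d k) (S N)).
  { apply abel_nonneg.
    - intros [|n]; [simpl; lra|]. rewrite Hsum. specialize (Hx n). lra.
    - intros n. assert (0 <= rho ^ n) by (apply pow_le; lra). simpl. nra. }
  rewrite Hw, tech5 in Hp.
  assert (0 <= x (S N) ^ 2 * rho ^ S N) by (apply Rmult_le_pos; [apply pow2_ge_0 | apply pow_le; lra]).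
  lra.
Qed.

Lemma geom_sum_from_1 q N :
  0 <= q -> sum_f_R0 (fun k => if Nat.eq_dec k 0 then 0 else q ^ k) N * (1 - q) <= q.
Proof.
  intros Hq.
  assert (E : sum_f_R0 (fun k => if Nat.eq_dec k 0 then 0 else q ^ k) N * (1 - q) = q - q ^ S N).
  { induction N as [|N IH]; [simpl; ring|].
    rewrite tech5, Rmult_plus_distr_r, IH. destruct (Nat.eq_dec (S N) 0); [lia|]. simpl. ring. }
  rewrite E. assert (0 <= q ^ S N) by (apply pow_le; exact Hq). lra.
Qed.

Lemma two_mult_le A y : 0 < A -> 2 * y <= A * y ^ 2 + / A.
Proof.
  intros HA. assert (H : 0 <= (A * y - 1) ^ 2 * / A).
  { apply Rmult_le_pos; [apply pow2_ge_0 | apply Rlt_le, Rinv_0_lt_compat, HA]. }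
  replace ((A * y - 1) ^ 2 * / A) with (A * y ^ 2 + / A - 2 * y) in H by (field; lra). lra.
Qed.

(** Weighted arithmetic-geometric means in place of the Cauchy-Schwarz inequality.
    For [r <= c] they give [b * r / (1 - r * c)], the value of the majorant series for
    a conformal map onto the cap, and this is at most [b / (1 + c)] exactly when
    [r * (1 + 2 * c) <= 1]. Otherwise [c <= 1 / 2], and the cruder bound
    [r / sqrt (1 - r ^ 2) <= 1 / sqrt 3] is good enough. *)
Lemma majorant_partial_sum_le x b c r N :
  0 < b -> 0 <= c -> b ^ 2 + c ^ 2 = 1 -> x 0%nat = 0 ->
  (forall n, sum_f_R0 (fun k => x k ^ 2) (S n) <= b ^ 2 + c ^ 2 * sum_f_R0 (fun k => x k ^ 2) n) ->
  0 <= r <= 1 / 2 -> r * (1 + 2 * c) <= 1 ->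
  sum_f_R0 (fun k => x k * r ^ k) N <= b / (1 + c).
Proof.
  intros Hb Hc Hbc H0 Hx Hr Hrc.
  assert (Hc1 : c < 1) by nra.
  assert (Hcase : (0 < c /\ r <= c) \/ c <= 1 / 2).
  { destruct (Rlt_or_le 0 c); [destruct (Rle_or_lt r c)|]; lra. }
  destruct Hcase as [[Hc0 Hle]|Hc2].
  - (* the weight rho = r / c makes both ratios c ^ 2 * rho and r ^ 2 / rho equal to r * c *)
    assert (Hrho : 0 <= r / c <= 1).
    { split; [apply Rmult_le_pos; [lra | apply Rlt_le, Rinv_0_lt_compat, Hc0]|].
      apply Rmult_le_reg_r with c; [exact Hc0|]. unfold Rdiv.
      rewrite Rmult_assoc, Rinv_l by lra. lra. }
    pose proof (shifted_square_sum_weighted x b c (r / c) N H0 Hx Hrho) as HT.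
    assert (Hq0 : 0 <= r * c) by (apply Rmult_le_pos; lra).
    pose proof (geom_sum_from_1 (r * c) N Hq0) as HU.
    set (T := sum_f_R0 (fun k => x k ^ 2 * (r / c) ^ k) N) in *.
    set (U := sum_f_R0 (fun k => if Nat.eq_dec k 0 then 0 else (r * c) ^ k) N) in *.
    assert (Hq : 0 < 1 - r * c) by nra.
    replace (1 - c ^ 2 * (r / c)) with (1 - r * c) in HT by (field; lra).
    assert (HS : 2 * sum_f_R0 (fun k => x k * r ^ k) N <= c / b * T + b / c * U).
    { unfold T, U. rewrite !scal_sum, <- plus_sum. apply sum_Rle. intros k _.
      destruct (Nat.eq_dec k 0) as [->|Hk].
      - rewrite H0. simpl. lra.
      - assert (Hck : 0 < c ^ k) by (apply pow_lt, Hc0).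
        assert (HA : 0 < c / b * / c ^ k).
        { apply Rmult_lt_0_compat; [apply Rdiv_lt_0_compat; assumption|].
          apply Rinv_0_lt_compat, Hck. }
        pose proof (two_mult_le _ (x k) HA) as Hm.
        assert (Hrk : 0 <= r ^ k) by (apply pow_le; lra).
        apply Rmult_le_compat_r with (r := r ^ k) in Hm; [|exact Hrk].
        unfold Rdiv at 1. rewrite !Rpow_mult_distr, pow_inv.
        replace ((c / b * / c ^ k * x k ^ 2 + / (c / b * / c ^ k)) * r ^ k) with
          (x k ^ 2 * (r ^ k * / c ^ k) * (c / b) + r ^ k * c ^ k * (b / c)) in Hm
          by (field; lra).
        lra. }
    assert (HT' : c / b * T <= b * r / (1 - r * c)).
    { apply Rmult_le_reg_r with ((1 - r * c) * (b / c)).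
      - apply Rmult_lt_0_compat; [exact Hq | apply Rdiv_lt_0_compat; assumption].
      - replace (c / b * T * ((1 - r * c) * (b / c))) with (T * (1 - r * c)) by (field; lra).
        replace (b * r / (1 - r * c) * ((1 - r * c) * (b / c))) with (r / c * b ^ 2) by (field; lra).
        exact HT. }
    assert (HU' : b / c * U <= b * r / (1 - r * c)).
    { apply Rmult_le_reg_r with ((1 - r * c) * (c / b)).
      - apply Rmult_lt_0_compat; [exact Hq | apply Rdiv_lt_0_compat; assumption].
      - replace (b / c * U * ((1 - r * c) * (c / b))) with (U * (1 - r * c)) by (field; lra).
        replace (b * r / (1 - r * c) * ((1 - r * c) * (c / b))) with (r * c) by (field; lra).
        exact HU. }
    assert (HF : b * r / (1 - r * c) <= b / (1 + c)).
    { apply Rmult_le_reg_r with ((1 - r * c) * (1 + c)).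
      - apply Rmult_lt_0_compat; lra.
      - replace (b * r / (1 - r * c) * ((1 - r * c) * (1 + c))) with (b * (r * (1 + c))) by (field; lra).
        replace (b / (1 + c) * ((1 - r * c) * (1 + c))) with (b * (1 - r * c)) by (field; lra).
        apply Rmult_le_compat_l; lra. }
    lra.
  - (* the square sums are at most 1, and r ^ 2 / (1 - r ^ 2) <= 1 / 3 <= mu ^ 2 *)
    set (mu := b / (1 + c)).
    assert (Hmu : 0 < mu) by (apply Rdiv_lt_0_compat; lra).
    assert (Hmu2 : 1 / 3 <= mu ^ 2).
    { apply Rmult_le_reg_r with ((1 + c) ^ 2); [apply pow_lt; lra|].
      replace (mu ^ 2 * (1 + c) ^ 2) with (b ^ 2) by (unfold mu; field; lra).
      replace (b ^ 2) with (1 - c ^ 2) by lra. nra. }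
    pose proof (shifted_square_sum_weighted x b c 1 N H0 Hx ltac:(lra)) as HT.
    pose proof (geom_sum_from_1 (r ^ 2) N (pow2_ge_0 r)) as HU.
    set (T := sum_f_R0 (fun k => x k ^ 2 * 1 ^ k) N) in *.
    set (U := sum_f_R0 (fun k => if Nat.eq_dec k 0 then 0 else (r ^ 2) ^ k) N) in *.
    assert (HT1 : T <= 1).
    { apply Rmult_le_reg_r with (b ^ 2); [apply pow_lt, Hb|].
      replace (b ^ 2) with (1 - c ^ 2 * 1) at 1 by lra. lra. }
    assert (HU1 : U <= 1 / 3).
    { assert (Hr2 : r ^ 2 <= 1 / 4) by nra. nra. }
    assert (HS : 2 * sum_f_R0 (fun k => x k * r ^ k) N <= mu * T + / mu * U).
    { unfold T, U. rewrite !scal_sum, <- plus_sum. apply sum_Rle. intros k _.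
      destruct (Nat.eq_dec k 0) as [->|Hk].
      - rewrite H0. simpl. lra.
      - rewrite pow1, <- pow_mult, Nat.mul_comm, pow_mult.
        assert (Hm : 0 <= (mu * x k - r ^ k) ^ 2 * / mu).
        { apply Rmult_le_pos; [apply pow2_ge_0 | apply Rlt_le, Rinv_0_lt_compat, Hmu]. }
        replace ((mu * x k - r ^ k) ^ 2 * / mu) with
          (mu * x k ^ 2 + (r ^ k) ^ 2 * / mu - 2 * (x k * r ^ k)) in Hm by (field; lra).
        lra. }
    assert (HU2 : / mu * U <= mu).
    { apply Rmult_le_reg_l with mu; [exact Hmu|].
      rewrite <- Rmult_assoc, Rinv_r, Rmult_1_l by lra. nra. }
    assert (mu * T <= mu * 1) by (apply Rmult_le_compat_l; lra).
    lra.
Qed.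

(** * Functions bounded by a hemisphere *)

Lemma cpoly_scal (s : C) a N z : cpoly (fun k => s * a k)%C N z = (s * cpoly a N z)%C.
Proof.
  induction N as [|N IH]; [unfold cpoly; simpl; ring|]. rewrite !cpoly_S, IH. ring.
Qed.

(** The closed hemispheres with the image of [0] in their interior project to
    exactly these disks, of centre [p] and radius [sqrt (1 + |p| ^ 2)]. *)
Definition in_cap (p w : C) : Prop := Cmod w ^ 2 - 2 * Re (w * Cconj p)%C <= 1.

Lemma in_cap_Cmod p w :
  in_cap p w -> sqrt (1 + Cmod p ^ 2) * Cmod w <= Cmod (1 + Cconj p * w).
Proof.
  intros H. unfold in_cap in H.
  assert (HR : 0 <= 1 + Cmod p ^ 2) by (pose proof (pow2_ge_0 (Cmod p)); lra).
  apply Rsqr_incr_0_var; [|apply Cmod_ge_0].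
  rewrite Rsqr_mult, Rsqr_sqrt by exact HR. rewrite !Rsqr_pow2.
  rewrite !Cmod2_alt in *. rewrite re_plus, im_plus, !re_mult, !im_mult, !re_conj, !im_conj in *.
  rewrite re_RtoC, im_RtoC. nra.
Qed.

Lemma cap_denominator_neq_0 p w : in_cap p w -> (1 + Cconj p * w)%C <> 0%C.
Proof.
  intros H E. pose proof (in_cap_Cmod p w H) as Hm. rewrite E, Cmod_0 in Hm.
  assert (HR : 0 < sqrt (1 + Cmod p ^ 2)).
  { apply sqrt_lt_R0. pose proof (pow2_ge_0 (Cmod p)). lra. }
  assert (Hw : Cmod w = 0) by (pose proof (Cmod_ge_0 w); nra).
  apply Cmod_eq_0 in Hw. subst w. rewrite Cmult_0_r, Cplus_0_r in E. exact (C1_nz E).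
Qed.

(** Rogosinski's inequality for the subordination of [F] to the disk. With
    [R ^ 2 = 1 + |p| ^ 2], the function [omega = R F / (1 + conj p F)] is bounded by one
    and vanishes at the origin, so in [R F = omega (1 + conj p F)] the Taylor
    coefficients of [R F] up to degree [N + 1] do not change when [1 + conj p F] is
    truncated at degree [N]. *)
Lemma cap_square_sum_le F a p N :
  holomorphic_on in_disk F -> (forall n, has_jet F a n) -> a 0%nat = RtoC 0 ->
  (forall z, in_disk z -> in_cap p (F z)) ->
  (1 + Cmod p ^ 2) * sum_f_R0 (fun k => Cmod (a k) ^ 2) (S N)
  <= 1 + Cmod p ^ 2 * sum_f_R0 (fun k => Cmod (a k) ^ 2) N.
Proof.
  intros HF HJ H0 Hcap.
  set (R := sqrt (1 + Cmod p ^ 2)).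
  assert (HR2 : R ^ 2 = 1 + Cmod p ^ 2).
  { apply pow2_sqrt. pose proof (pow2_ge_0 (Cmod p)). lra. }
  assert (HR : 0 < R).
  { apply sqrt_lt_R0. pose proof (pow2_ge_0 (Cmod p)). lra. }
  set (den := fun z => (1 + Cconj p * F z)%C).
  assert (Hden : forall z, in_disk z -> den z <> 0%C).
  { intros z Hz. apply cap_denominator_neq_0, Hcap, Hz. }
  set (omega := fun z => (RtoC R * (F z * / den z))%C).
  assert (Homega : forall z, in_disk z -> Cmod (omega z) <= 1).
  { intros z Hz. unfold omega. rewrite !Cmod_mult, Cmod_inv, Cmod_R, Rabs_pos_eq by (auto; lra).
    pose proof (in_cap_Cmod p (F z) (Hcap z Hz)) as Hm. fold R (den z) in Hm.
    assert (Hd : 0 < Cmod (den z)) by (apply Cmod_gt_0, Hden, Hz).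
    apply Rmult_le_reg_r with (Cmod (den z)); [exact Hd|].
    rewrite <- Rmult_assoc, Rmult_assoc, Rinv_l by lra. lra. }
  assert (Hden_holo : holomorphic_on in_disk den).
  { apply (holomorphic_plus _ (fun _ => RtoC 1)); [apply holomorphic_const|].
    apply (holomorphic_mult _ (fun _ => Cconj p)); [apply holomorphic_const | exact HF]. }
  assert (Homega_holo : holomorphic_on in_disk omega).
  { apply (holomorphic_mult _ (fun _ => RtoC R)); [apply holomorphic_const|].
    apply (holomorphic_mult _ F); [exact HF|]. apply holomorphic_inv; assumption. }
  set (h := fun k : nat => if Nat.eq_dec k 0 then RtoC 1 else (Cconj p * a k)%C).
  assert (Hh : forall z, cpoly h N z = (1 + Cconj p * cpoly a N z)%C).
  { intros z. induction N as [|n IH].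
    - unfold cpoly, h; simpl. rewrite H0. ring.
    - rewrite !cpoly_S, IH. unfold h. destruct (Nat.eq_dec (S n) 0); [lia|]. ring. }
  assert (Hhs : sum_f_R0 (fun k => Cmod (h k) ^ 2) N =
                1 + Cmod p ^ 2 * sum_f_R0 (fun k => Cmod (a k) ^ 2) N).
  { clear Hh. induction N as [|n IH].
    - simpl. unfold h; simpl. rewrite H0, Cmod_1, Cmod_0. ring.
    - rewrite !tech5, IH. unfold h. destruct (Nat.eq_dec (S n) 0); [lia|].
      rewrite Cmod_mult, Cmod_conj. ring. }
  set (Phi := fun z => (omega z * cpoly h N z)%C).
  assert (HPhi_holo : holomorphic_on in_disk Phi).
  { apply holomorphic_mult; [exact Homega_holo | apply holomorphic_cpoly]. }
  assert (HPhi_le : forall z, in_disk z -> Cmod (Phi z) <= Cmod (cpoly h N z)).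
  { intros z Hz. unfold Phi. rewrite Cmod_mult. rewrite <- (Rmult_1_l (Cmod (cpoly h N z))) at 2.
    apply Rmult_le_compat_r; [apply Cmod_ge_0 | apply Homega, Hz]. }
  assert (HPhi_jet : has_jet Phi (fun k => RtoC R * a k)%C (S N)).
  { destruct (HJ 0%nat) as (K1 & d1 & HK1 & Hd1 & J1).
    destruct (HJ N) as (K2 & d2 & HK2 & Hd2 & J2).
    destruct (HJ (S N)) as (K3 & d3 & HK3 & Hd3 & J3).
    pose proof (Cmod_ge_0 p) as Pp.
    assert (HpK : 0 <= Cmod p * K1) by (apply Rmult_le_pos; assumption).
    set (d4 := / (2 * (Cmod p * K1 + 1))).
    assert (Hd4 : 0 < d4) by (apply Rinv_0_lt_compat; lra).
    exists (2 * R * K1 * (Cmod p * K2) + R * K3), (Rmin 1 (Rmin (Rmin d1 d2) (Rmin d3 d4))).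
    split; [|split].
    - apply Rplus_le_le_0_compat; repeat apply Rmult_le_pos; lra.
    - repeat apply Rmin_pos; lra.
    - intros z Hz.
      pose proof (Rmin_l 1 (Rmin (Rmin d1 d2) (Rmin d3 d4))).
      pose proof (Rmin_r 1 (Rmin (Rmin d1 d2) (Rmin d3 d4))).
      pose proof (Rmin_l (Rmin d1 d2) (Rmin d3 d4)).
      pose proof (Rmin_r (Rmin d1 d2) (Rmin d3 d4)).
      pose proof (Rmin_l d1 d2). pose proof (Rmin_r d1 d2).
      pose proof (Rmin_l d3 d4). pose proof (Rmin_r d3 d4).
      specialize (J1 z ltac:(lra)). specialize (J2 z ltac:(lra)). specialize (J3 z ltac:(lra)).
      assert (Hzd : in_disk z) by (unfold in_disk; lra).
      replace (F z - cpoly a 0 z)%C with (F z) in J1 by (unfold cpoly; simpl; rewrite H0; ring).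
      rewrite pow_1 in J1. pose proof (Cmod_ge_0 z) as Pz.
      assert (Hz4 : Cmod p * K1 * Cmod z <= 1 / 2).
      { assert (Hx : Cmod z <= d4) by lra.
        apply Rmult_le_compat_l with (r := Cmod p * K1 + 1) in Hx; [|lra].
        replace ((Cmod p * K1 + 1) * d4) with (1 / 2) in Hx by (unfold d4; field; lra). lra. }
      assert (Hdz : 1 / 2 <= Cmod (den z)).
      { pose proof (Cmod_sub_ge (RtoC 1) (- (Cconj p * F z))%C) as Hs.
        replace (1 - - (Cconj p * F z))%C with (den z) in Hs by (unfold den; ring).
        rewrite Cmod_1, Cmod_opp, Cmod_mult, Cmod_conj in Hs.
        assert (Cmod p * Cmod (F z) <= Cmod p * (K1 * Cmod z)) by (apply Rmult_le_compat_l; assumption).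
        lra. }
      assert (Hoz : Cmod (omega z) <= 2 * R * K1 * Cmod z).
      { unfold omega. rewrite !Cmod_mult, Cmod_inv, Cmod_R, Rabs_pos_eq by (auto; lra).
        assert (Hi : / Cmod (den z) <= 2).
        { replace 2 with (/ (1 / 2)) by field. apply Rinv_le_contravar; lra. }
        assert (Hi0 : 0 <= / Cmod (den z)) by (apply Rlt_le, Rinv_0_lt_compat; lra).
        replace (2 * R * K1 * Cmod z) with (R * (K1 * Cmod z * 2)) by ring.
        apply Rmult_le_compat_l; [lra|].
        apply Rmult_le_compat; auto using Cmod_ge_0. }
      rewrite cpoly_scal. unfold Phi. rewrite Hh.
      assert (E : (omega z * (1 + Cconj p * cpoly a N z) - R * cpoly a (S N) z)%C =
        (- (omega z * (Cconj p * (F z - cpoly a N z))) + R * (F z - cpoly a (S N) z))%C).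
      { assert (E2 : (omega z * den z)%C = (R * F z)%C).
        { unfold omega. field. apply Hden, Hzd. }
        unfold den in E2.
        replace (R * (F z - cpoly a (S N) z))%C with (R * F z - R * cpoly a (S N) z)%C by ring.
        rewrite <- E2. ring. }
      rewrite E. eapply Rle_trans; [apply Cmod_triangle|].
      rewrite Cmod_opp, !Cmod_mult, Cmod_conj, Cmod_R, (Rabs_pos_eq R) by lra.
      assert (A1 : Cmod (omega z) * (Cmod p * Cmod (F z - cpoly a N z)) <=
                   2 * R * K1 * Cmod z * (Cmod p * (K2 * Cmod z ^ S N))).
      { apply Rmult_le_compat; auto using Cmod_ge_0, Rmult_le_pos.
        apply Rmult_le_compat_l; assumption. }
      assert (A2 : R * Cmod (F z - cpoly a (S N) z) <= R * (K3 * Cmod z ^ S (S N))).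
      { apply Rmult_le_compat_l; [lra | exact J3]. }
      replace ((2 * R * K1 * (Cmod p * K2) + R * K3) * Cmod z ^ S (S N)) with
        (2 * R * K1 * Cmod z * (Cmod p * (K2 * Cmod z ^ S N)) + R * (K3 * Cmod z ^ S (S N)))
        by (simpl; ring).
      lra. }
  pose proof (jet_square_sum_le Phi _ (S N) h N HPhi_holo HPhi_jet HPhi_le) as HB.
  rewrite Hhs in HB. rewrite <- HR2. eapply Rle_trans; [|exact HB].
  right. rewrite scal_sum. apply sum_eq. intros k _.
  rewrite Cmod_mult, Cmod_R, Rabs_pos_eq by lra. ring.
Qed.

(** The right-hand side is the distance from the origin to the complement of the
    cap. The assumption [alpha <= sqrt 3 / 2] gives [r <= 1 / 2], and the square sum
    inequality for the first coefficient bounds the parameter [c = |p| / R] of the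
    cap by [sqrt (1 - alpha ^ 2)]. *)
Lemma cap_majorant_le F a p alpha r N :
  holomorphic_on in_disk F -> (forall n, has_jet F a n) -> a 0%nat = RtoC 0 -> a 1%nat = RtoC alpha ->
  (forall z, in_disk z -> in_cap p (F z)) ->
  0 < alpha -> alpha <= sqrt 3 / 2 -> 0 <= r <= bohr_radius_s alpha ->
  sum_f_R0 (fun k => Cmod (a k) * r ^ k) N <= sqrt (1 + Cmod p ^ 2) - Cmod p.
Proof.
  intros HF HJ H0 H1 Hcap Ha0 Ha Hr.
  set (R := sqrt (1 + Cmod p ^ 2)).
  assert (HR2 : R ^ 2 = 1 + Cmod p ^ 2).
  { apply pow2_sqrt. pose proof (pow2_ge_0 (Cmod p)). lra. }
  assert (HR : 0 < R).
  { apply sqrt_lt_R0. pose proof (pow2_ge_0 (Cmod p)). lra. }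
  pose proof (Cmod_ge_0 p) as Pp.
  assert (Ha2 : alpha ^ 2 <= 3 / 4).
  { replace (3 / 4) with ((sqrt 3 / 2) ^ 2).
    - apply pow_incr. lra.
    - unfold Rdiv. rewrite Rpow_mult_distr, pow2_sqrt by lra. field. }
  set (s := sqrt (1 - alpha ^ 2)).
  assert (Hs2 : s ^ 2 = 1 - alpha ^ 2) by (apply pow2_sqrt; lra).
  assert (Hs0 : 0 <= s) by apply sqrt_pos.
  assert (Hs : 1 / 2 <= s) by nra.
  unfold bohr_radius_s in Hr. fold s in Hr.
  assert (Hrs : r * (1 + 2 * s) <= 1).
  { destruct Hr as [_ Hr]. apply Rmult_le_compat_r with (r := 1 + 2 * s) in Hr; [|lra].
    replace (1 / (1 + 2 * s) * (1 + 2 * s)) with 1 in Hr by (field; lra). exact Hr. }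
  assert (HSq : forall n, sum_f_R0 (fun k => Cmod (a k) ^ 2) (S n) <=
    (/ R) ^ 2 + (Cmod p / R) ^ 2 * sum_f_R0 (fun k => Cmod (a k) ^ 2) n).
  { intros n. pose proof (cap_square_sum_le F a p n HF HJ H0 Hcap) as Hn.
    rewrite <- HR2 in Hn. assert (HR2p : 0 < R ^ 2) by (apply pow_lt, HR).
    apply Rmult_le_reg_l with (R ^ 2); [exact HR2p|]. eapply Rle_trans; [exact Hn|].
    right. field. lra. }
  assert (Hal : alpha ^ 2 * R ^ 2 <= 1).
  { pose proof (cap_square_sum_le F a p 0 HF HJ H0 Hcap) as Hn.
    simpl sum_f_R0 in Hn. rewrite H0, H1, Cmod_0, Cmod_R, (Rabs_pos_eq alpha) in Hn by lra.
    rewrite HR2. lra. }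
  set (c := Cmod p / R) in *.
  assert (Hc0 : 0 <= c).
  { apply Rmult_le_pos; [exact Pp | apply Rlt_le, Rinv_0_lt_compat, HR]. }
  assert (Hbc : (/ R) ^ 2 + c ^ 2 = 1).
  { unfold c. replace ((/ R) ^ 2 + (Cmod p / R) ^ 2) with ((1 + Cmod p ^ 2) / R ^ 2) by (field; lra).
    rewrite <- HR2. field. lra. }
  assert (Hcs : c <= s).
  { assert (c ^ 2 <= s ^ 2).
    { rewrite Hs2. assert (alpha ^ 2 <= (/ R) ^ 2).
      { apply Rmult_le_reg_r with (R ^ 2); [apply pow_lt, HR|].
        replace ((/ R) ^ 2 * R ^ 2) with 1 by (field; lra). exact Hal. }
      lra. }
    nra. }
  replace (R - Cmod p) with (/ R / (1 + c)).
  - apply majorant_partial_sum_le; auto.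
    + apply Rinv_0_lt_compat, HR.
    + rewrite H0. apply Cmod_0.
    + split; [lra|]. nra.
    + nra.
  - assert (E : (R - Cmod p) * (R + Cmod p) = 1).
    { replace ((R - Cmod p) * (R + Cmod p)) with (R ^ 2 - Cmod p ^ 2) by ring. lra. }
    apply Rmult_eq_reg_r with (R + Cmod p); [|lra]. rewrite E. unfold c. field. split; lra.
Qed.

(** * Supporting hemispheres of a spherically convex set *)

(** A Hahn-Banach extension in two steps: the functional is [1] on the third
    basis vector, and each of the two remaining values is a supremum. No
    topology of the cone enters, so it need not be closed or open. *)
Lemma cone_separation (K : R -> R -> R -> Prop) (B : R) :
  (forall l x y z, 0 < l -> K x y z -> K (l * x) (l * y) (l * z)) ->
  (forall x y z x' y' z', K x y z -> K x' y' z' ->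
     ~ (x + x' = 0 /\ y + y' = 0 /\ z + z' = 0) -> K (x + x') (y + y') (z + z')) ->
  K 0 0 1 -> (exists s, K 1 0 s) -> (exists s, K 0 1 s) -> (exists s, K 0 (-1) s) ->
  ~ K 1 0 B ->
  exists n1 n2, (forall x y z, K x y z -> 0 <= n1 * x + n2 * y + z) /\ n1 + B <= 0.
Proof.
  intros Hsc Hadd He [s1 Hs1] [s2 Hs2] [s3 Hs3] HB.
  assert (Hup : forall s t, K 1 0 s -> s <= t -> K 1 0 t).
  { intros s t Hs Hst. destruct (Req_dec s t) as [->|Hne]; [exact Hs|].
    pose proof (Hsc (t - s) 0 0 1 ltac:(lra) He) as H1.
    pose proof (Hadd _ _ _ _ _ _ Hs H1 ltac:(lra)) as H2.
    replace (1 + (t - s) * 0) with 1 in H2 by ring.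
    replace (0 + (t - s) * 0) with 0 in H2 by ring.
    replace (s + (t - s) * 1) with t in H2 by ring. exact H2. }
  assert (Hneg : forall t, K 0 0 t -> 0 <= t).
  { intros t Ht. apply Rnot_lt_le. intros Hlt. apply HB.
    destruct (Rle_or_lt s1 B) as [Hle|Hgt]; [exact (Hup _ _ Hs1 Hle)|].
    assert (Hl : 0 < (s1 - B) / - t) by (apply Rdiv_lt_0_compat; lra).
    pose proof (Hsc _ 0 0 t Hl Ht) as H1.
    pose proof (Hadd _ _ _ _ _ _ Hs1 H1 ltac:(lra)) as H2.
    replace (1 + (s1 - B) / - t * 0) with 1 in H2 by ring.
    replace (0 + (s1 - B) / - t * 0) with 0 in H2 by ring.
    replace (s1 + (s1 - B) / - t * t) with B in H2 by (field; lra). exact H2. }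
  destruct (completeness (fun v => K 1 0 (- v))) as [xi [Hxi1 Hxi2]].
  { exists (- B). intros v Hv. apply Rnot_lt_le. intros Hlt. apply HB.
    apply (Hup (- v)); [exact Hv | lra]. }
  { exists (- s1). rewrite Ropp_involutive. exact Hs1. }
  assert (HxiB : xi + B <= 0).
  { assert (xi <= - B); [|lra]. apply Hxi2. intros v Hv. apply Rnot_lt_le. intros Hlt.
    apply HB. apply (Hup (- v)); [exact Hv | lra]. }
  assert (Hplane : forall x z, K x 0 z -> 0 <= xi * x + z).
  { intros x z Hk. destruct (Rtotal_order x 0) as [Hx|[->|Hx]].
    - assert (Hl : 0 < / - x) by (apply Rinv_0_lt_compat; lra).
      pose proof (Hsc _ _ _ _ Hl Hk) as H1.
      assert (Hxz : xi <= / - x * z).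
      { apply Hxi2. intros v Hv. apply Rnot_lt_le. intros Hlt.
        pose proof (Hadd _ _ _ _ _ _ Hv H1 ltac:(lra)) as H2.
        replace (1 + / - x * x) with 0 in H2 by (field; lra).
        replace (0 + / - x * 0) with 0 in H2 by ring.
        apply Hneg in H2. lra. }
      apply Rmult_le_compat_l with (r := - x) in Hxz; [|lra].
      replace (- x * (/ - x * z)) with z in Hxz by (field; lra). lra.
    - apply Hneg in Hk. lra.
    - assert (Hl : 0 < / x) by (apply Rinv_0_lt_compat; lra).
      pose proof (Hsc _ _ _ _ Hl Hk) as H1.
      replace (/ x * x) with 1 in H1 by (field; lra).
      replace (/ x * 0) with 0 in H1 by ring.
      assert (Hxz : - (/ x * z) <= xi).
      { apply Hxi1. rewrite Ropp_involutive. exact H1. }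
      apply Rmult_le_compat_l with (r := x) in Hxz; [|lra].
      replace (x * - (/ x * z)) with (- z) in Hxz by (field; lra). lra. }
  assert (Hopp : forall x z x' z', K x 1 z -> K x' (-1) z' -> - (xi * x + z) <= xi * x' + z').
  { intros x z x' z' H1 H2.
    destruct (classic (x + x' = 0 /\ 1 + -1 = 0 /\ z + z' = 0)) as [(E1 & _ & E2)|Hne].
    - replace x' with (- x) by lra. lra.
    - pose proof (Hadd _ _ _ _ _ _ H1 H2 Hne) as H3.
      replace (1 + -1) with 0 in H3 by ring. apply Hplane in H3. lra. }
  destruct (completeness (fun v => exists x z, K x 1 z /\ v = - (xi * x + z))) as [eta [He1 He2]].
  { exists (xi * 0 + s3). intros v (x & z & Hk & ->). exact (Hopp _ _ _ _ Hk Hs3). }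
  { exists (- (xi * 0 + s2)), 0, s2. auto. }
  exists xi, eta. split; [|exact HxiB].
  intros x y z Hk. destruct (Rtotal_order y 0) as [Hy|[->|Hy]].
  - assert (Hl : 0 < / - y) by (apply Rinv_0_lt_compat; lra).
    pose proof (Hsc _ _ _ _ Hl Hk) as H1.
    replace (/ - y * y) with (-1) in H1 by (field; lra).
    assert (Hyz : eta <= xi * (/ - y * x) + / - y * z).
    { apply He2. intros v (x' & z' & Hk' & ->). exact (Hopp _ _ _ _ Hk' H1). }
    apply Rmult_le_compat_l with (r := - y) in Hyz; [|lra].
    replace (- y * (xi * (/ - y * x) + / - y * z)) with (xi * x + z) in Hyz by (field; lra). lra.
  - apply Hplane in Hk. lra.
  - assert (Hl : 0 < / y) by (apply Rinv_0_lt_compat; lra).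
    pose proof (Hsc _ _ _ _ Hl Hk) as H1.
    replace (/ y * y) with 1 in H1 by (field; lra).
    assert (Hyz : - (xi * (/ y * x) + / y * z) <= eta).
    { apply He1. exists (/ y * x), (/ y * z). split; [exact H1 | reflexivity]. }
    apply Rmult_le_compat_l with (r := y) in Hyz; [|lra].
    replace (y * - (xi * (/ y * x) + / y * z)) with (- (xi * x + z)) in Hyz by (field; lra). lra.
Qed.

Lemma stereo_surjective a b c :
  a ^ 2 + b ^ 2 + c ^ 2 = 1 -> exists w, stereo w = (a, b, c).
Proof.
  intros H. destruct (Req_dec c 1) as [->|Hc].
  - exists None. assert (a = 0) by nra. assert (b = 0) by nra. subst. reflexivity.
  - exists (Some (a / (1 - c), b / (1 - c))). simpl stereo.
    assert (Hm : Cmod (a / (1 - c), b / (1 - c)) * (Cmod (a / (1 - c), b / (1 - c)) * 1)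
                 = (1 + c) / (1 - c)).
    { transitivity (Cmod (a / (1 - c), b / (1 - c)) ^ 2); [reflexivity|].
      rewrite Cmod2_alt. unfold Re, Im; simpl fst; simpl snd.
      replace ((a / (1 - c)) ^ 2 + (b / (1 - c)) ^ 2) with ((a ^ 2 + b ^ 2) / (1 - c) ^ 2)
        by (field; lra).
      replace (a ^ 2 + b ^ 2) with ((1 - c) * (1 + c)) by (ring_simplify; lra). field. lra. }
    rewrite Hm. unfold Re, Im; simpl fst; simpl snd.
    f_equal; [f_equal|]; field; lra.
Qed.

Lemma on_minor_arc_coords w1 w2 w a b c a' b' c' s t :
  stereo w1 = (a, b, c) -> stereo w2 = (a', b', c') -> 0 <= s -> 0 <= t ->
  stereo w = (s * a + t * a', s * b + t * b', s * c + t * c') -> on_minor_arc w1 w2 w.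
Proof.
  intros H1 H2 Hs Ht Hw. exists s, t. rewrite H1, H2. split; [exact Hs|].
  split; [exact Ht|]. exact Hw.
Qed.

(** The cone over the image of [E] on the sphere, in coordinates where the
    first horizontal axis points to [d] and the third axis to the image of [0]. *)
Definition cone_over (E : Chat -> Prop) (d : C) (x y z : R) : Prop :=
  exists l w, 0 < l /\ E w /\
    stereo w = (l * Re (d * (x, y))%C, l * Im (d * (x, y))%C, - (l * z)).

Lemma cone_over_scal E d l x y z :
  0 < l -> cone_over E d x y z -> cone_over E d (l * x) (l * y) (l * z).
Proof.
  intros Hl (m & w & Hm & Hw & Hs). exists (m / l), w.
  split; [apply Rdiv_lt_0_compat; assumption|]. split; [exact Hw|]. rewrite Hs.
  rewrite !re_mult, !im_mult. unfold Re, Im; simpl.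
  f_equal; [f_equal|]; field; lra.
Qed.

(** Minor arcs are the traces of nonnegative combinations, so spherical
    convexity is closure of the cone under addition; opposite vectors are left
    out because antipodal points have no minor arc. *)
Lemma cone_over_add E d x y z x' y' z' :
  d <> RtoC 0 -> spherically_convex E -> cone_over E d x y z -> cone_over E d x' y' z' ->
  ~ (x + x' = 0 /\ y + y' = 0 /\ z + z' = 0) -> cone_over E d (x + x') (y + y') (z + z').
Proof.
  intros Hd HE (l & w & Hl & Hw & Hs) (l' & w' & Hl' & Hw' & Hs') Hne.
  set (v := (d * (x + x', y + y')%R)%C).
  set (q := Re v ^ 2 + Im v ^ 2 + (z + z') ^ 2).
  assert (Hq : 0 < q).
  { assert (P1 := pow2_ge_0 (Re v)). assert (P2 := pow2_ge_0 (Im v)).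
    assert (P3 := pow2_ge_0 (z + z')).
    destruct (Req_dec q 0) as [E0|E0]; [exfalso | unfold q in *; lra].
    apply Hne. assert (Hz : z + z' = 0) by (unfold q in *; nra).
    assert (Hv : Cmod v = 0).
    { assert (H2 : Cmod v ^ 2 = 0) by (rewrite Cmod2_alt; unfold q in *; lra). nra. }
    unfold v in Hv. rewrite Cmod_mult in Hv. apply Rmult_integral in Hv.
    destruct Hv as [Hv|Hv]; apply Cmod_eq_0 in Hv; [contradiction|].
    injection Hv as E1 E2. auto. }
  set (n := sqrt q). assert (Hn : 0 < n) by (apply sqrt_lt_R0, Hq).
  assert (Hn2 : n ^ 2 = q) by (apply pow2_sqrt; lra).
  destruct (stereo_surjective (/ n * Re v) (/ n * Im v) (- (/ n * (z + z')))) as [w'' Hs''].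
  { replace ((/ n * Re v) ^ 2 + (/ n * Im v) ^ 2 + (- (/ n * (z + z'))) ^ 2) with (q / n ^ 2)
      by (unfold q; field; lra).
    rewrite Hn2. field. lra. }
  exists (/ n), w''. split; [apply Rinv_0_lt_compat, Hn|]. split; [|exact Hs''].
  apply (HE w w' w'' Hw Hw').
  apply (on_minor_arc_coords _ _ _ _ _ _ _ _ _ (/ (n * l)) (/ (n * l')) Hs Hs').
  { apply Rlt_le, Rinv_0_lt_compat, Rmult_lt_0_compat; assumption. }
  { apply Rlt_le, Rinv_0_lt_compat, Rmult_lt_0_compat; assumption. }
  rewrite Hs''. unfold v. rewrite !re_mult, !im_mult. unfold Re, Im; simpl.
  f_equal; [f_equal|]; field; lra.
Qed.

Lemma cone_over_point (E : Chat -> Prop) d u :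
  d <> RtoC 0 -> E (Some u) ->
  cone_over E d (Re (u / d)%C) (Im (u / d)%C) ((1 - Cmod u ^ 2) / 2).
Proof.
  intros Hd Hu. assert (Hm := pow2_ge_0 (Cmod u)).
  exists (2 / (1 + Cmod u ^ 2)), (Some u).
  split; [apply Rdiv_lt_0_compat; lra|]. split; [exact Hu|].
  replace (d * (Re (u / d), Im (u / d)))%C with u.
  - simpl stereo. f_equal; [f_equal|]; field; simpl in Hm; lra.
  - replace ((Re (u / d), Im (u / d)) : C)%C with (u / d)%C by (destruct (u / d)%C; reflexivity).
    field. exact Hd.
Qed.

(** The cone need not be known to contain a neighbourhood of the axis: two image
    points on either side of the ray through [d] already produce a point above it. *)
Lemma cone_over_direction (f : C -> Chat) (F : C -> C) d alpha a :
  d <> RtoC 0 -> 0 < alpha -> spherically_convex (disk_image f) ->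
  has_jet F a 1 -> a 0%nat = RtoC 0 -> a 1%nat = RtoC alpha ->
  (exists e, 0 < e /\ forall z, Cmod z < e -> f z = Some (F z)) ->
  exists s, cone_over (disk_image f) d 1 0 s.
Proof.
  intros Hd Ha HE (K & d0 & HK & Hd0 & HJ) H0 H1 (e0 & He0 & Hf).
  assert (Pd : 0 < Cmod d) by (apply Cmod_gt_0, Hd).
  set (m := Rmin 1 (Rmin d0 e0)).
  assert (Hm : 0 < m) by (repeat apply Rmin_pos; lra).
  set (e := Rmin (m / (4 * Cmod d)) (alpha / (8 * (K * Cmod d + 1)))).
  assert (HKd : 0 <= K * Cmod d) by (apply Rmult_le_pos; lra).
  assert (He : 0 < e) by (apply Rmin_pos; apply Rdiv_lt_0_compat; lra).
  assert (Hem : e * Cmod d <= m / 4).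
  { assert (Hx : e <= m / (4 * Cmod d)) by apply Rmin_l.
    apply Rmult_le_compat_r with (r := Cmod d) in Hx; [|lra].
    replace (m / (4 * Cmod d) * Cmod d) with (m / 4) in Hx by (field; lra). exact Hx. }
  assert (HeK : 8 * K * Cmod d * e < alpha).
  { assert (Hx : e <= alpha / (8 * (K * Cmod d + 1))) by apply Rmin_r.
    apply Rmult_le_compat_r with (r := 8 * (K * Cmod d + 1)) in Hx; [|lra].
    replace (alpha / (8 * (K * Cmod d + 1)) * (8 * (K * Cmod d + 1))) with alpha in Hx
      by (field; lra). nra. }
  pose proof (Rmin_l 1 (Rmin d0 e0)) as M1. pose proof (Rmin_r 1 (Rmin d0 e0)) as M2.
  pose proof (Rmin_l d0 e0) as M3. pose proof (Rmin_r d0 e0) as M4. fold m in M1, M2.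
  assert (Hpt : forall y, Rabs y = 1 -> exists u, disk_image f (Some u) /\
            Rabs (Re (u / d)%C - alpha * e) < alpha * e /\
            Rabs (Im (u / d)%C - alpha * e * y) < alpha * e).
  { intros y Hy. set (z := (RtoC e * d * (1, y)%R)%C).
    assert (H1y : Cmod (1, y) <= 2).
    { eapply Rle_trans; [apply Cmod_pair_le|]. rewrite Hy, Rabs_R1. lra. }
    assert (Hz : Cmod z <= 2 * (e * Cmod d)).
    { unfold z. rewrite !Cmod_mult, Cmod_R, (Rabs_pos_eq e) by lra.
      assert (0 <= e * Cmod d) by (apply Rmult_le_pos; lra).
      rewrite Rmult_comm. apply Rmult_le_compat_r; assumption. }
    assert (Hzm : Cmod z < m) by lra.
    exists (F z). split.
    { exists z. split; [unfold in_disk; lra|]. apply Hf. lra. }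
    specialize (HJ z ltac:(lra)).
    replace (F z - cpoly a 1 z)%C with (F z - alpha * z)%C in HJ
      by (unfold cpoly; simpl; rewrite H0, H1; ring).
    assert (Herr : Cmod (F z / d - RtoC (alpha * e) * (1, y)%R) < alpha * e).
    { replace (F z / d - RtoC (alpha * e) * (1, y)%R)%C with ((F z - alpha * z) * / d)%C.
      - rewrite Cmod_mult, Cmod_inv by exact Hd.
        assert (Hb : Cmod (F z - alpha * z) <= K * (2 * (e * Cmod d)) ^ 2).
        { eapply Rle_trans; [exact HJ|]. apply Rmult_le_compat_l; [exact HK|].
          apply pow_incr. split; [apply Cmod_ge_0 | exact Hz]. }
        apply Rmult_lt_reg_r with (Cmod d); [exact Pd|].
        rewrite Rmult_assoc, Rinv_l, Rmult_1_r by lra.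
        eapply Rle_lt_trans; [exact Hb|].
        replace (K * (2 * (e * Cmod d)) ^ 2) with ((8 * K * Cmod d * e) * (e * Cmod d) / 2) by field.
        assert (0 < e * Cmod d) by (apply Rmult_lt_0_compat; lra). nra.
      - unfold z. rewrite RtoC_mult. field. exact Hd. }
    split; (eapply Rle_lt_trans; [|exact Herr]).
    - eapply Rle_trans; [|apply Rabs_Re_le]. right. f_equal.
      unfold Cminus. rewrite re_plus, re_opp, re_scal_l. change (Re (1, y)) with 1. ring.
    - eapply Rle_trans; [|apply Rabs_Im_le]. right. f_equal.
      unfold Cminus. rewrite im_plus, im_opp, im_scal_l. change (Im (1, y)) with y. ring. }
  destruct (Hpt 1 Rabs_R1) as (u & Hu & Hu1 & Hu2).
  destruct (Hpt (-1) ltac:(rewrite Rabs_left; lra)) as (v & Hv & Hv1 & Hv2).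
  apply Rabs_def2 in Hu1, Hu2, Hv1, Hv2.
  apply (cone_over_point _ d u Hd) in Hu. apply (cone_over_point _ d v Hd) in Hv.
  set (u1 := Re (u / d)%C) in *. set (u2 := Im (u / d)%C) in *.
  set (v1 := Re (v / d)%C) in *. set (v2 := Im (v / d)%C) in *.
  apply cone_over_scal with (l := - v2) in Hu; [|lra].
  apply cone_over_scal with (l := u2) in Hv; [|lra].
  assert (Hpos : 0 < - v2 * u1 + u2 * v1).
  { assert (0 < - v2 * u1) by (apply Rmult_lt_0_compat; lra).
    assert (0 < u2 * v1) by (apply Rmult_lt_0_compat; lra). lra. }
  pose proof (cone_over_add _ d _ _ _ _ _ _ Hd HE Hu Hv ltac:(lra)) as Hs.
  apply cone_over_scal with (l := / (- v2 * u1 + u2 * v1)) in Hs; [|apply Rinv_0_lt_compat, Hpos].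
  rewrite Rinv_l in Hs by lra.
  replace (/ (- v2 * u1 + u2 * v1) * (- v2 * u2 + u2 * v2)) with 0 in Hs by ring.
  eexists. exact Hs.
Qed.

(** The separating plane passes through the centre of the sphere and cuts off a
    hemisphere containing the image of [f]; the sign of the functional at infinity
    excludes poles, and its sign at [w] puts [w] outside the open cap. *)
Lemma spherically_convex_support (f : C -> Chat) (F : C -> C) w alpha a :
  0 < alpha -> spherically_convex (disk_image f) ->
  has_jet F a 1 -> a 0%nat = RtoC 0 -> a 1%nat = RtoC alpha ->
  (exists e, 0 < e /\ forall z, Cmod z < e -> f z = Some (F z)) ->
  ~ disk_image f (Some w) ->
  exists p, (forall u, disk_image f (Some u) -> in_cap p u) /\ ~ disk_image f None /\
            sqrt (1 + Cmod p ^ 2) - Cmod p <= Cmod w.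
Proof.
  intros Ha HE HJ H0 H1 Hf Hw.
  assert (HF0 : F (RtoC 0) = (RtoC 0)).
  { destruct HJ as (K & d0 & HK & Hd0 & HJ). specialize (HJ (RtoC 0)).
    rewrite Cmod_0 in HJ. specialize (HJ Hd0).
    replace (F 0 - cpoly a 1 0)%C with (F 0) in HJ
      by (unfold cpoly; simpl; rewrite H0, H1; ring).
    apply Cmod_eq_0. pose proof (Cmod_ge_0 (F 0)). simpl in HJ. lra. }
  assert (HE0 : disk_image f (Some (RtoC 0))).
  { exists (RtoC 0). split; [unfold in_disk; rewrite Cmod_0; lra|].
    destruct Hf as (e & He & Hf). rewrite Hf by (rewrite Cmod_0; exact He). now rewrite HF0. }
  assert (Hw0 : w <> (RtoC 0)) by (intros ->; exact (Hw HE0)).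
  set (K := cone_over (disk_image f) w).
  assert (Hdir : forall y, Rabs y = 1 -> exists s, K 0 y s).
  { intros y Hy.
    assert (Hq : (w * (0, y)%R)%C <> (RtoC 0)).
    { apply Cmult_neq_0; [exact Hw0|]. intros E. injection E as E. rewrite E, Rabs_R0 in Hy. lra. }
    destruct (cone_over_direction f F (w * (0, y)%R)%C alpha a Hq Ha HE HJ H0 H1 Hf)
      as (s & l & u & Hl & Hu & Hs).
    exists s, l, u. split; [exact Hl|]. split; [exact Hu|]. rewrite Hs.
    rewrite !re_mult, !im_mult. unfold Re, Im; simpl. f_equal; f_equal; ring. }
  destruct (cone_separation K ((1 - Cmod w ^ 2) / 2)) as (n1 & n2 & Hn & HnB).
  - intros l x y z. apply cone_over_scal.
  - intros x y z x' y' z'. apply cone_over_add; assumption.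
  - pose proof (cone_over_point _ w (RtoC 0) Hw0 HE0) as Hp.
    apply cone_over_scal with (l := 2) in Hp; [|lra].
    replace (0 / w)%C with (RtoC 0) in Hp by (unfold Cdiv; ring).
    unfold Re, Im in Hp. simpl fst in Hp. simpl snd in Hp. rewrite Cmod_0 in Hp.
    replace (2 * 0) with 0 in Hp by ring. replace (2 * ((1 - 0 ^ 2) / 2)) with 1 in Hp by field.
    exact Hp.
  - exact (cone_over_direction f F w alpha a Hw0 Ha HE HJ H0 H1 Hf).
  - apply Hdir, Rabs_R1.
  - apply Hdir. rewrite Rabs_left; lra.
  - intros (l & u & Hl & Hu & Hs). apply Hw.
    (* a degenerate arc: the image of [w] is a positive multiple of that of [u] *)
    assert (Hm := pow2_ge_0 (Cmod w)).
    assert (Hlm : 0 < l * (1 + Cmod w ^ 2)) by (apply Rmult_lt_0_compat; lra).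
    apply (HE u u (Some w) Hu Hu).
    apply (on_minor_arc_coords _ _ _ _ _ _ _ _ _ (2 / (l * (1 + Cmod w ^ 2))) 0 Hs Hs); [|lra|].
    { apply Rlt_le, Rdiv_lt_0_compat; lra. }
    rewrite re_mult, im_mult. unfold stereo. set (m := Cmod w ^ 2) in *. cbv zeta.
    unfold Re, Im; simpl fst; simpl snd.
    f_equal; [f_equal|]; field; split; lra.
  - set (q := ((n1, - n2)%R / w)%C). exists (Cconj q).
    assert (Hre : forall u, Re (u * q)%C = n1 * Re (u / w)%C + n2 * Im (u / w)%C).
    { intros u. unfold q. replace (u * ((n1, - n2)%R / w))%C with ((u / w) * (n1, - n2)%R)%C
        by (field; exact Hw0).
      rewrite re_mult. change (Re (n1, - n2)) with n1. change (Im (n1, - n2)) with (- n2). ring. }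
    split; [|split].
    + intros u Hu. unfold in_cap. rewrite Cconj_conj, Hre.
      pose proof (Hn _ _ _ (cone_over_point _ w u Hw0 Hu)). lra.
    + intros HN. assert (HK : K 0 0 (-1)).
      { exists 1, None. split; [lra|]. split; [exact HN|]. rewrite re_mult, im_mult.
        unfold Re, Im; simpl. f_equal; [f_equal|]; ring. }
      apply Hn in HK. lra.
    + rewrite Cmod_conj.
      assert (Hq1 : - n1 <= Cmod w * Cmod q).
      { rewrite <- Cmod_mult. eapply Rle_trans; [|apply re_le_Cmod].
        rewrite Hre. replace (w / w)%C with (RtoC 1) by (field; exact Hw0).
        rewrite re_RtoC, im_RtoC, <- Rabs_Ropp. eapply Rle_trans; [|apply Rle_abs]. lra. }
      pose proof (Cmod_ge_0 q) as Pq. pose proof (Cmod_ge_0 w) as Pw.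
      assert (Hs : sqrt (1 + Cmod q ^ 2) <= Cmod w + Cmod q); [|lra].
      rewrite <- (sqrt_pow2 (Cmod w + Cmod q)) by lra. apply sqrt_le_1_alt. nra.
Qed.

(** * The majorant series of a spherically convex function *)

(** Where only [1 / f] has a power series, it has no zero because [f] is finite, so
    [f] is the reciprocal of a nonvanishing strictly differentiable function. *)
Lemma meromorphic_finite_holomorphic f :
  meromorphic_on_disk f -> (forall z, in_disk z -> f z <> None) ->
  holomorphic_on in_disk (fun z => finite_part (f z)).
Proof.
  intros Hm Hfin z0 Hz0. destruct (Hm z0 Hz0) as [[a Ha]|[a Ha]].
  - exists (a 1%nat). exact (expands_at_strict_derive f z0 a Ha).
  - pose proof (expands_at_strict_derive _ z0 a Ha) as HG.
    set (G := fun z => finite_part (Chat_inv (f z))) in HG.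
    destruct (expands_at_bounds _ z0 a Ha) as (_ & _ & d & _ & _ & Hd & _ & Hs).
    assert (Hd' : 0 < Rmin d (1 - Cmod z0)) by (apply Rmin_pos; unfold in_disk in Hz0; lra).
    assert (HFG : forall z, Cmod (z - z0) < Rmin d (1 - Cmod z0) ->
              G z <> RtoC 0 /\ (/ G z)%C = finite_part (f z)).
    { intros z Hz. pose proof (Rmin_l d (1 - Cmod z0)). pose proof (Rmin_r d (1 - Cmod z0)).
      assert (Hzd : in_disk z) by (unfold in_disk; pose proof (Cmod_sub_ge z z0); lra).
      destruct (Hs z ltac:(lra)) as (w & Hw & _). unfold G.
      specialize (Hfin z Hzd). destruct (f z) as [u|]; [|contradiction].
      unfold Chat_inv in *. destruct (Ceq_dec u (RtoC 0)) as [E0|E0]; [discriminate|].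
      simpl finite_part. split.
      - intros E1. apply C1_nz. rewrite <- (Cinv_r u E0), E1. ring.
      - field. exact E0. }
    eexists. apply (strict_derive_ext_loc (fun z => / G z)%C _ _ _ _ Hd').
    + intros z Hz. apply HFG, Hz.
    + apply strict_derive_inv; [|exact HG].
      apply HFG. replace (z0 - z0)%C with (RtoC 0) by ring. rewrite Cmod_0. exact Hd'.
Qed.

Lemma expands_at_finite f z0 a :
  expands_at f z0 a -> exists e, 0 < e /\ forall z, Cmod (z - z0) < e -> f z = Some (finite_part (f z)).
Proof.
  intros H. destruct (expands_at_bounds f z0 a H) as (_ & _ & d & _ & _ & Hd & _ & Hs).
  exists d. split; [exact Hd|]. intros z Hz. destruct (Hs z Hz) as (w & Hw & _). now rewrite Hw.
Qed.

(** The bound is stated for omitted values because boundary points are limits of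
    such values, while a boundary point is itself omitted only by the openness of
    the image. *)
Lemma omitted_value_majorant_le f a alpha w r N :
  Ks alpha f -> expands_at f (RtoC 0) a -> ~ disk_image f (Some w) ->
  0 < alpha -> alpha <= sqrt 3 / 2 -> 0 <= r <= bohr_radius_s alpha ->
  sum_f_R0 (fun k => Cmod (a k) * r ^ k) N <= Cmod w.
Proof.
  intros [(Hm & _ & HE) (b & Hb & Hb0 & Hb1)] Ha Hw Ha0 Hal Hr.
  set (F := fun z => finite_part (f z)).
  assert (Hfin0 : exists e, 0 < e /\ forall z, Cmod z < e -> f z = Some (F z)).
  { destruct (expands_at_finite f _ a Ha) as (e & He & H). exists e. split; [exact He|].
    intros z Hz. apply H. replace (z - 0)%C with z by ring. exact Hz. }
  destruct (spherically_convex_support f F w alpha b Ha0 HE (expands_at_jet f b 1 Hb) Hb0 Hb1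
              Hfin0 Hw) as (p & Hcap & HNone & Hp).
  assert (Hfin : forall z, in_disk z -> f z <> None).
  { intros z Hz E0. apply HNone. exists z. auto. }
  assert (HF : holomorphic_on in_disk F) by (apply meromorphic_finite_holomorphic; assumption).
  eapply Rle_trans; [|exact Hp].
  apply cap_majorant_le with (F := F) (alpha := alpha); try assumption.
  - intros n. apply expands_at_jet, Ha.
  - rewrite <- Hb0. apply (jet_unique F a b 0 0 HF); [| | lia]; apply expands_at_jet; assumption.
  - rewrite <- Hb1. apply (jet_unique F a b 1 1 HF); [| | lia]; apply expands_at_jet; assumption.
  - intros z Hz. apply Hcap. exists z. split; [exact Hz|]. unfold F.
    specialize (Hfin z Hz). destruct (f z); [reflexivity | contradiction].
Qed.

Lemma majorant_le_boundary_dist f a alpha r :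
  Ks alpha f -> expands_at f (RtoC 0) a ->
  0 < alpha -> alpha <= sqrt 3 / 2 -> 0 <= r <= bohr_radius_s alpha ->
  Rbar_le (majorant_series a r) (boundary_dist f).
Proof.
  intros HK Ha Ha0 Hal Hr. unfold boundary_dist.
  apply (proj2 (Glb_Rbar_correct _)). intros d (w0 & w & Hw0 & [_ Hw] & ->).
  assert (E0 : w0 = RtoC 0).
  { destruct HK as [_ (b & Hb & Hb0 & _)].
    destruct (expands_at_jet f b 0 Hb) as (K & e & _ & He & HJ).
    specialize (HJ (RtoC 0)). rewrite Cmod_0, Hw0 in HJ. specialize (HJ He).
    unfold cpoly in HJ; simpl in HJ. rewrite Hb0 in HJ.
    replace (w0 - 0 * 1)%C with w0 in HJ by ring.
    apply Cmod_eq_0. pose proof (Cmod_ge_0 w0). lra. }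
  subst w0. replace (w - 0)%C with w by ring.
  assert (Hsum : forall N, sum_f_R0 (fun k => Cmod (a k) * r ^ k) N <= Cmod w).
  { intros N. apply le_epsilon. intros e He. apply NNPP. intros Hcon. apply Hw.
    apply locally_disc. exists e. split; [exact He|]. intros u Hu. apply NNPP. intros Hnu.
    apply Hcon.
    eapply Rle_trans; [exact (omitted_value_majorant_le f a alpha u r N HK Ha Hnu Ha0 Hal Hr)|].
    pose proof (Cmod_sub_ge u w). lra. }
  unfold majorant_series. rewrite <- (Lim_seq_const (Cmod w)).
  apply Lim_seq_le_loc. exists 0%nat. intros n _. rewrite sum_n_Reals. apply Hsum.
Qed.

(** * The extremal function *)

Lemma extremal_constants alpha :
  0 < alpha -> alpha <= sqrt 3 / 2 ->
  1 / 2 <= sqrt (1 - alpha ^ 2) < 1 /\ sqrt (1 - alpha ^ 2) ^ 2 = 1 - alpha ^ 2.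
Proof.
  intros Ha0 Ha.
  assert (Ha2 : alpha ^ 2 <= 3 / 4).
  { replace (3 / 4) with ((sqrt 3 / 2) ^ 2).
    - apply pow_incr. lra.
    - unfold Rdiv. rewrite Rpow_mult_distr, pow2_sqrt by lra. field. }
  assert (Hs2 : sqrt (1 - alpha ^ 2) ^ 2 = 1 - alpha ^ 2) by (apply pow2_sqrt; lra).
  pose proof (sqrt_pos (1 - alpha ^ 2)). repeat split; [nra | nra | exact Hs2].
Qed.

(** With [d = 1 - c * z0] and [h = z - z0], the Taylor coefficients at [z0] come from
    [alpha z / (1 - c z) = alpha z0 / d + (alpha h / d ^ 2) / (1 - c h / d)]. *)
Definition mobius_coeff (alpha c : R) (z0 : C) (n : nat) : C :=
  let d := (1 - c * z0)%C in
  match n with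
  | O => (alpha * z0 / d)%C
  | S m => (alpha / (d * d) * (c / d) ^ m)%C
  end.

Lemma mobius_denominator_neq_0 c z : 0 <= c < 1 -> in_disk z -> (1 - c * z)%C <> RtoC 0.
Proof.
  intros Hc Hz E0. pose proof (Cmod_sub_ge (RtoC 1) (c * z)%C) as H.
  rewrite E0, Cmod_0, Cmod_1, Cmod_mult, Cmod_R, Rabs_pos_eq in H by lra.
  unfold in_disk in Hz. pose proof (Cmod_ge_0 z). nra.
Qed.

Lemma k_extremal_expands alpha z0 :
  let c := sqrt (1 - alpha ^ 2) in
  0 < c < 1 -> in_disk z0 -> expands_at (k_extremal alpha) z0 (mobius_coeff alpha c z0).
Proof.
  intros c Hc Hz0. unfold k_extremal. fold c.
  set (d := (1 - c * z0)%C).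
  assert (Hd : d <> RtoC 0) by (apply mobius_denominator_neq_0; [lra | exact Hz0]).
  assert (Pd : 0 < Cmod d) by (apply Cmod_gt_0, Hd).
  apply (proj2 (locally_disc z0 _)). exists (Cmod d / 2). split; [lra|].
  intros z Hz. eexists. split; [reflexivity|].
  set (h := (z - z0)%C) in *. set (q := (c / d * h)%C).
  assert (Hq : Cmod q <= 1 / 2).
  { unfold q, Cdiv. rewrite !Cmod_mult, Cmod_inv, Cmod_R, Rabs_pos_eq by (auto; lra).
    apply Rmult_le_reg_r with (Cmod d); [exact Pd|].
    replace (c * / Cmod d * Cmod h * Cmod d) with (c * Cmod h) by (field; lra).
    pose proof (Cmod_ge_0 h). nra. }
  assert (Hq1 : (1 - q)%C <> RtoC 0).
  { intros E0. pose proof (Cmod_sub_ge (RtoC 1) q) as H. rewrite E0, Cmod_0, Cmod_1 in H. lra. }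
  assert (Hden : (1 - c * z)%C = (d * (1 - q))%C).
  { unfold q, d, h. field. exact Hd. }
  set (A := (alpha * h / (d * d) / (1 - q))%C).
  assert (Hsum : forall N, csum (fun n => mobius_coeff alpha c z0 n * h ^ n)%C N =
            (alpha * z / (1 - c * z) - A * q ^ N)%C).
  { rewrite Hden.
    replace (alpha * z / (d * (1 - q)))%C with (alpha * z0 / d + A)%C.
    - intros N. induction N as [|N IH].
      + simpl. fold d. ring.
      + rewrite csum_S, IH. cbv beta.
        change (mobius_coeff alpha c z0 (S N)) with (alpha / (d * d) * (c / d) ^ N)%C.
        assert (E1 : (q ^ N)%C = ((c / d) ^ N * h ^ N)%C) by (unfold q; apply Cpow_mult_l).
        rewrite (Cpow_S q N), (Cpow_S h N).
        replace (alpha / (d * d) * (c / d) ^ N * (h * h ^ N))%C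
          with (A * (1 - q) * ((c / d) ^ N * h ^ N))%C.
        * rewrite <- E1. ring.
        * unfold A. field. repeat split; assumption.
    - assert (Ez : z = (z0 + h)%C) by (unfold h; ring).
      assert (Ed : (RtoC 1 = d + c * z0)%C) by (unfold d; ring).
      assert (Eq : (c * h = d * q)%C) by (unfold q; field; exact Hd).
      rewrite Ez. unfold A.
      replace (alpha * (z0 + h) / (d * (1 - q)))%C with
        ((alpha * z0 * d * (1 - q) + alpha * (z0 * (d * q) + h * d)) / (d * d * (1 - q)))%C
        by (field; auto).
      rewrite <- Eq.
      replace (z0 * (c * h) + h * d)%C with (h * (d + c * z0))%C by ring. rewrite <- Ed.
      field. auto. }
  unfold is_pseries.
  apply (is_series_ext (K := C_AbsRing) (V := C_NormedModule)
           (fun n => (mobius_coeff alpha c z0 n * h ^ n)%C)).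
  { intros n. apply Cmult_comm. }
  apply csum_is_series. intros e He.
  assert (PA := Cmod_ge_0 A).
  destruct (pow_lt_1_zero (1 / 2) ltac:(rewrite Rabs_pos_eq; lra) (e / (Cmod A + 1))) as [M HM].
  { apply Rdiv_lt_0_compat; lra. }
  exists M. intros n Hn. rewrite Hsum.
  replace (alpha * z / (1 - c * z) - A * q ^ n - alpha * z / (1 - c * z))%C
    with (- (A * q ^ n))%C by ring.
  rewrite Cmod_opp, Cmod_mult, Cmod_pow.
  specialize (HM n Hn). rewrite Rabs_pos_eq in HM by (apply pow_le; lra).
  assert (Hqn : Cmod q ^ n <= (1 / 2) ^ n) by (apply pow_incr; split; [apply Cmod_ge_0 | exact Hq]).
  assert (Hqp : 0 <= Cmod q ^ n) by (apply pow_le, Cmod_ge_0).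
  apply Rmult_lt_compat_l with (r := Cmod A + 1) in HM; [|lra].
  replace ((Cmod A + 1) * (e / (Cmod A + 1))) with e in HM by (field; lra).
  nra.
Qed.

(** The inverse map is [u / (alpha + c u)], and [|u| < |alpha + c u|] is linear in the
    coordinates on the sphere: the image of the disk is a hemisphere. *)
Lemma k_extremal_image alpha w :
  0 < alpha -> alpha <= sqrt 3 / 2 ->
  disk_image (k_extremal alpha) w <->
  0 < sqrt (1 - alpha ^ 2) * fst (fst (stereo w)) - alpha * snd (stereo w).
Proof.
  intros Ha0 Ha. destruct (extremal_constants alpha Ha0 Ha) as [Hc Hc2].
  unfold k_extremal. set (c := sqrt (1 - alpha ^ 2)) in *.
  assert (Hu : forall u : C,
    0 < c * fst (fst (stereo (Some u))) - alpha * snd (stereo (Some u)) <->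
    Cmod u < Cmod (alpha + c * u)).
  { intros u. unfold stereo. cbv zeta. cbn [fst snd].
    assert (Hm := pow2_ge_0 (Cmod u)).
    assert (Hi : 0 < / (1 + Cmod u ^ 2)) by (apply Rinv_0_lt_compat; lra).
    replace (c * (2 * Re u / (1 + Cmod u ^ 2)) - alpha * ((Cmod u ^ 2 - 1) / (1 + Cmod u ^ 2)))
      with ((2 * c * Re u + alpha * (1 - Cmod u ^ 2)) * / (1 + Cmod u ^ 2)) by (field; lra).
    assert (E0 : Cmod (alpha + c * u) ^ 2 - Cmod u ^ 2 =
                 alpha * (2 * c * Re u + alpha * (1 - Cmod u ^ 2))).
    { rewrite !Cmod2_alt, re_plus, im_plus, re_scal_l, im_scal_l, re_RtoC, im_RtoC.
      replace ((alpha + c * Re u) ^ 2 + (0 + c * Im u) ^ 2 - (Re u ^ 2 + Im u ^ 2)) with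
        (alpha ^ 2 + 2 * alpha * c * Re u + (c ^ 2 - 1) * (Re u ^ 2 + Im u ^ 2)) by ring.
      rewrite Hc2. ring. }
    pose proof (Cmod_ge_0 u). pose proof (Cmod_ge_0 (alpha + c * u)).
    set (X := 2 * c * Re u + alpha * (1 - Cmod u ^ 2)) in *.
    split; intros H1.
    - assert (HX : 0 < X).
      { apply Rmult_lt_reg_r with (1 := Hi). rewrite Rmult_0_l. exact H1. }
      assert (0 < alpha * X) by (apply Rmult_lt_0_compat; assumption). nra.
    - apply Rmult_lt_0_compat; [|exact Hi]. apply Rmult_lt_reg_l with (1 := Ha0). nra. }
  split.
  - intros (z & Hz & <-). apply Hu.
    pose proof (mobius_denominator_neq_0 c z ltac:(lra) Hz) as Hd.
    assert (Haz : RtoC alpha <> RtoC 0) by (intros E0; apply RtoC_inj in E0; lra).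
    set (u := (alpha * z / (1 - c * z))%C).
    assert (Hw : u = (z * (alpha + c * u))%C) by (unfold u; field; exact Hd).
    assert (Hp : 0 < Cmod (alpha + c * u)).
    { apply Cmod_gt_0. replace (alpha + c * u)%C with (alpha / (1 - c * z))%C by (unfold u; field; exact Hd).
      unfold Cdiv. apply Cmult_neq_0; [exact Haz|]. apply Cmod_gt_0.
      rewrite Cmod_inv by exact Hd. apply Rinv_0_lt_compat, Cmod_gt_0, Hd. }
    rewrite Hw at 1. rewrite Cmod_mult. unfold in_disk in Hz.
    pose proof (Cmod_ge_0 z). nra.
  - destruct w as [u|].
    + intros H. apply Hu in H. pose proof (Cmod_ge_0 u).
      assert (Hp : 0 < Cmod (alpha + c * u)) by lra.
      assert (Hne : (alpha + c * u)%C <> RtoC 0) by (apply Cmod_gt_0, Hp).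
      exists (u / (alpha + c * u))%C. split.
      * unfold in_disk. rewrite Cmod_div by exact Hne.
        apply Rmult_lt_reg_r with (Cmod (alpha + c * u)); [exact Hp|].
        unfold Rdiv. rewrite Rmult_assoc, Rinv_l by lra. lra.
      * f_equal. assert (Haz : RtoC alpha <> RtoC 0) by (intros E0; apply RtoC_inj in E0; lra).
        field. split; [exact Hne|].
        replace (alpha + c * u - c * u)%C with (RtoC alpha) by ring. exact Haz.
    + simpl. intros H. exfalso. nra.
Qed.

Lemma stereo_neq_0 w : stereo w <> (0, 0, 0).
Proof.
  destruct w as [u|]; unfold stereo; cbv zeta; intros E0; injection E0.
  - intros E3 E2 E1. assert (Hm := Cmod2_alt u).
    assert (Hp := pow2_ge_0 (Cmod u)).
    assert (Hi : / (1 + Cmod u ^ 2) <> 0) by (apply Rinv_neq_0_compat; lra).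
    unfold Rdiv in *.
    apply Rmult_integral in E1. apply Rmult_integral in E2. apply Rmult_integral in E3.
    assert (Re u = 0) by (destruct E1; [lra | contradiction]).
    assert (Im u = 0) by (destruct E2; [lra | contradiction]).
    assert (Cmod u ^ 2 = 1) by (destruct E3; [lra | contradiction]). nra.
  - intros. lra.
Qed.

Lemma k_extremal_Ks alpha :
  0 < alpha -> alpha <= sqrt 3 / 2 -> Ks alpha (k_extremal alpha).
Proof.
  intros Ha0 Ha. destruct (extremal_constants alpha Ha0 Ha) as [Hc Hc2].
  pose proof (k_extremal_expands alpha) as Hexp. cbv zeta in Hexp.
  split; [split; [|split]|].
  - intros z Hz. left. eexists. apply Hexp; [lra | exact Hz].
  - intros z1 z2 Hz1 Hz2 E0. apply (f_equal finite_part) in E0.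
    set (c := sqrt (1 - alpha ^ 2)) in *.
    change ((alpha * z1 / (1 - c * z1))%C = (alpha * z2 / (1 - c * z2))%C) in E0.
    pose proof (mobius_denominator_neq_0 c z1 ltac:(lra) Hz1) as D1.
    pose proof (mobius_denominator_neq_0 c z2 ltac:(lra) Hz2) as D2.
    assert (Haz : RtoC alpha <> RtoC 0) by (intros E1; apply RtoC_inj in E1; lra).
    apply Ceq_minus.
    replace (z1 - z2)%C with
      ((alpha * z1 / (1 - c * z1) - alpha * z2 / (1 - c * z2)) * (1 - c * z1) * (1 - c * z2) / alpha)%C
      by (field; auto).
    rewrite E0. field. auto.
  - intros w1 w2 w H1 H2 (s & t & Hs & Ht & Hw).
    apply k_extremal_image in H1; [|assumption..]. apply k_extremal_image in H2; [|assumption..].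
    apply k_extremal_image; [assumption..|].
    pose proof (stereo_neq_0 w) as Hne.
    destruct (stereo w1) as [[x1 y1] v1]. destruct (stereo w2) as [[x2 y2] v2].
    destruct (stereo w) as [[x y] v].
    change ((x, y, v) = (s * x1 + t * x2, s * y1 + t * y2, s * v1 + t * v2)) in Hw.
    injection Hw as -> -> ->. simpl in *.
    set (c := sqrt (1 - alpha * (alpha * 1))) in *.
    replace (c * (s * x1 + t * x2) - alpha * (s * v1 + t * v2)) with
      (s * (c * x1 - alpha * v1) + t * (c * x2 - alpha * v2)) by ring.
    destruct (Rle_lt_or_eq_dec 0 s Hs) as [Hs'|<-].
    + apply Rplus_lt_le_0_compat; [apply Rmult_lt_0_compat; assumption|].
      apply Rmult_le_pos; lra.
    + destruct (Rle_lt_or_eq_dec 0 t Ht) as [Ht'|<-].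
      * rewrite Rmult_0_l, Rplus_0_l. apply Rmult_lt_0_compat; assumption.
      * exfalso. apply Hne. f_equal; [f_equal|]; ring.
  - eexists. split; [apply Hexp; [lra|unfold in_disk; rewrite Cmod_0; lra]|].
    split; unfold mobius_coeff; simpl; field; intros E0;
      assert (E1 : RtoC 1 = RtoC 0) by (rewrite <- E0; ring); exact (C1_nz E1).
Qed.

(** The boundary point used is [- alpha / (1 + c)], the limit of [k_extremal] at [-1]. *)
Lemma k_extremal_boundary_dist alpha :
  0 < alpha -> alpha <= sqrt 3 / 2 ->
  Rbar_le (boundary_dist (k_extremal alpha)) (alpha / (1 + sqrt (1 - alpha ^ 2))).
Proof.
  intros Ha0 Ha. destruct (extremal_constants alpha Ha0 Ha) as [Hc Hc2].
  apply (proj1 (Glb_Rbar_correct _)).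
  set (c := sqrt (1 - alpha ^ 2)) in *. set (b := alpha / (1 + c)).
  assert (Hb : 0 < b) by (apply Rdiv_lt_0_compat; lra).
  assert (Hbc : b * (1 + c) = alpha) by (unfold b; field; lra).
  assert (Him : forall x, 0 < x ->
     (disk_image (k_extremal alpha) (Some (RtoC (- x))) <-> 0 < (b - x) * (b * (1 + c) + (1 - c) * x))).
  { intros x Hx. rewrite (k_extremal_image alpha _ Ha0 Ha). fold c.
    unfold stereo. cbv zeta. cbn [fst snd]. rewrite Cmod_R, pow2_abs.
    change (Re (- x)%R) with (- x).
    assert (Hi : 0 < / (1 + (- x) ^ 2)) by (apply Rinv_0_lt_compat; nra).
    assert (Hne : 1 + (- x) ^ 2 <> 0) by nra.
    replace (c * (2 * - x / (1 + (- x) ^ 2)) - alpha * (((- x) ^ 2 - 1) / (1 + (- x) ^ 2)))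
      with ((alpha - 2 * c * x - alpha * x ^ 2) * / (1 + (- x) ^ 2)) by (field; exact Hne).
    assert (E0 : (b - x) * (b * (1 + c) + (1 - c) * x) = b * (alpha - 2 * c * x - alpha * x ^ 2)).
    { assert (E1 : alpha * b = 1 - c).
      { apply Rmult_eq_reg_r with (1 + c); [|lra]. rewrite Rmult_assoc, Hbc.
        replace (alpha * alpha) with (alpha ^ 2) by ring. replace (alpha ^ 2) with (1 - c ^ 2) by lra. ring. }
      replace ((b - x) * (b * (1 + c) + (1 - c) * x)) with
        (b * (b * (1 + c)) - 2 * c * x * b - (1 - c) * x ^ 2) by ring.
      rewrite Hbc, <- E1. ring. }
    rewrite E0. split; intros H.
    - apply Rmult_lt_0_compat; [exact Hb|]. nra.
    - apply Rmult_lt_0_compat; [|exact Hi]. nra. }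
  exists (RtoC 0), (RtoC (- b)). split; [|split].
  - unfold k_extremal, Cdiv. rewrite (Cmult_0_r alpha), Cmult_0_l. reflexivity.
  - split; intros H; apply locally_disc in H; destruct H as (d & Hd & H).
    + set (e := Rmin (d / 2) (b / 2)). assert (He : 0 < e) by (apply Rmin_pos; lra).
      assert (e <= d / 2) by apply Rmin_l. assert (e <= b / 2) by apply Rmin_r.
      apply (H (RtoC (- (b - e)))).
      * rewrite <- RtoC_minus, Cmod_R. replace (- (b - e) - - b) with e by ring.
        rewrite Rabs_pos_eq; lra.
      * apply Him; [lra|]. apply Rmult_lt_0_compat; [lra|]. nra.
    + assert (Hin : disk_image (k_extremal alpha) (Some (RtoC (- (b + d / 2))))).
      { apply H. rewrite <- RtoC_minus, Cmod_R. replace (- (b + d / 2) - - b) with (- (d / 2)) by ring.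
        rewrite Rabs_Ropp, Rabs_pos_eq; lra. }
      apply Him in Hin; [|lra].
      assert (0 < b * (1 + c) + (1 - c) * (b + d / 2)) by nra. nra.
  - rewrite <- RtoC_minus, Cmod_R. replace (- b - 0) with (- b) by ring.
    rewrite Rabs_Ropp, Rabs_pos_eq; lra.
Qed.

(** The partial sums tend to [alpha * r / (1 - c * r)], which exceeds
    [alpha / (1 + c)] when [r * (1 + 2 * c) > 1]. *)
Lemma k_extremal_radius_sharp alpha a r :
  0 < alpha -> alpha <= sqrt 3 / 2 -> expands_at (k_extremal alpha) (RtoC 0) a ->
  bohr_radius_s alpha < r < 1 ->
  ~ Rbar_le (majorant_series a r) (boundary_dist (k_extremal alpha)).
Proof.
  intros Ha0 Ha Hexp Hr Hle.
  pose proof (Rbar_le_trans _ _ _ Hle (k_extremal_boundary_dist alpha Ha0 Ha)) as HM. clear Hle.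
  destruct (extremal_constants alpha Ha0 Ha) as [Hc Hc2].
  unfold bohr_radius_s in Hr.
  assert (H0d : in_disk (RtoC 0)) by (unfold in_disk; rewrite Cmod_0; lra).
  pose proof (k_extremal_expands alpha) as Hb. cbv zeta in Hb.
  set (c := sqrt (1 - alpha ^ 2)) in *.
  assert (HF : holomorphic_on in_disk (fun z => finite_part (k_extremal alpha z))).
  { apply meromorphic_finite_holomorphic; [|discriminate].
    intros z Hz. left. eexists. apply Hb; [lra | exact Hz]. }
  assert (Hcoef : forall n, a n = mobius_coeff alpha c (RtoC 0) n).
  { intros n. apply (jet_unique _ a _ n n HF); [apply expands_at_jet, Hexp | | lia].
    apply expands_at_jet, Hb; [lra | exact H0d]. }
  assert (H10 : (1 - c * 0)%C = RtoC 1) by ring.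
  assert (Ha_0 : Cmod (a 0%nat) = 0).
  { rewrite Hcoef. unfold mobius_coeff. cbv zeta. rewrite H10, Cmult_0_r.
    unfold Cdiv. rewrite Cmult_0_l. apply Cmod_0. }
  assert (Ha_S : forall n, Cmod (a (S n)) = alpha * c ^ n).
  { intros n. rewrite Hcoef. unfold mobius_coeff. cbv zeta. rewrite H10.
    replace (alpha / (1 * 1) * (c / 1) ^ n)%C with (alpha * c ^ n)%C.
    - rewrite Cmod_mult, Cmod_pow, !Cmod_R, !Rabs_pos_eq by lra. reflexivity.
    - replace (c / 1)%C with (RtoC c) by (field; exact C1_nz). field. }
  assert (Hr0 : 0 < r).
  { apply Rlt_trans with (1 / (1 + 2 * c)); [apply Rdiv_lt_0_compat; lra | lra]. }
  assert (Hcr : 0 < 1 - c * r) by nra.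
  assert (Hsum : forall N, sum_f_R0 (fun k => Cmod (a k) * r ^ k) N * (1 - c * r) =
                           alpha * r * (1 - (c * r) ^ N)).
  { induction N as [|N IH].
    - simpl. rewrite Ha_0. ring.
    - rewrite tech5, Rmult_plus_distr_r, IH, Ha_S, !Rpow_mult_distr. simpl. ring. }
  assert (HN : forall N, sum_f_R0 (fun k => Cmod (a k) * r ^ k) N <= alpha / (1 + c)).
  { intros N. assert (HL : Rbar_le (sum_f_R0 (fun k => Cmod (a k) * r ^ k) N) (majorant_series a r)).
    { rewrite <- Lim_seq_const. apply Lim_seq_le_loc. exists N. intros n Hn. rewrite sum_n_Reals.
      induction Hn as [|n Hn IH]; [lra|]. rewrite tech5.
      assert (0 <= Cmod (a (S n)) * r ^ S n) by (apply Rmult_le_pos; [apply Cmod_ge_0 | apply pow_le; lra]).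
      lra. }
    exact (Rbar_le_trans _ _ _ HL HM). }
  assert (Hgap : 0 < r * (1 + 2 * c) - 1).
  { destruct Hr as [Hr _]. apply Rmult_lt_compat_r with (r := 1 + 2 * c) in Hr; [|lra].
    replace (1 / (1 + 2 * c) * (1 + 2 * c)) with 1 in Hr by (field; lra). lra. }
  destruct (pow_lt_1_zero (c * r) ltac:(rewrite Rabs_pos_eq; nra) ((r * (1 + 2 * c) - 1) / 2)) as [N HNz].
  { lra. }
  specialize (HNz N (le_n N)).
  assert (Hpow : 0 <= (c * r) ^ N) by (apply pow_le; nra).
  rewrite Rabs_pos_eq in HNz by exact Hpow.
  specialize (HN N). specialize (Hsum N).
  apply Rmult_le_compat_r with (r := (1 - c * r) * (1 + c)) in HN;
    [|apply Rmult_le_pos; lra].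
  rewrite <- Rmult_assoc, Hsum in HN.
  replace (alpha / (1 + c) * ((1 - c * r) * (1 + c))) with (alpha * (1 - c * r)) in HN by (field; lra).
  assert (HN' : r * (1 - (c * r) ^ N) * (1 + c) <= 1 - c * r).
  { apply Rmult_le_reg_l with alpha; [exact Ha0|]. lra. }
  assert (r * (c * r) ^ N * (1 + c) <= 2 * (c * r) ^ N).
  { assert (r * (1 + c) <= 2) by nra.
    replace (r * (c * r) ^ N * (1 + c)) with (r * (1 + c) * (c * r) ^ N) by ring.
    apply Rmult_le_compat_r; assumption. }
  lra.
Qed.

Theorem theorem6 :
  forall alpha : R, 0 < alpha -> alpha <= sqrt 3 / 2 ->
    (forall (f : C -> Chat) (a : nat -> C),
        Ks alpha f -> expands_at f (RtoC 0) a ->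
        forall r : R, 0 <= r <= bohr_radius_s alpha ->
          Rbar_le (majorant_series a r) (boundary_dist f)) /\
    Ks alpha (k_extremal alpha) /\
    (forall a : nat -> C, expands_at (k_extremal alpha) (RtoC 0) a ->
        forall r : R, bohr_radius_s alpha < r < 1 ->
          ~ Rbar_le (majorant_series a r) (boundary_dist (k_extremal alpha))).
Proof.
  intros alpha Ha0 Ha. split; [|split].
  - intros f a HK Hexp r Hr. exact (majorant_le_boundary_dist f a alpha r HK Hexp Ha0 Ha Hr).
  - exact (k_extremal_Ks alpha Ha0 Ha).
  - intros a Hexp r Hr. exact (k_extremal_radius_sharp alpha a r Ha0 Ha Hexp Hr).
Qed.
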